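(* Let $\Bbbk$ be a field, let $R=\Bbbk[x_1,\dots,x_m]$, let $I$ be a monomial ideal of $R$, and let $\mathcal{B}=\mathcal{B}(I,\Bbbk)$ be its Betti poset over $\Bbbk$. Let $\mathcal{P}$ be a subposet of $\mathbb{Z}^m$ such that $\mathcal{B}\subseteq\mathcal{P}\subseteq\deg(I)$. (a) For any $\alpha\in\mathbb{Z}^m$ and any $d\ge0$ we have $\beta_{d,\alpha}(I)=0$ if $\alpha\notin\mathcal{P}$, and otherwise $$\beta_{d,\alpha}(I)=\dim_\Bbbk\widetilde{H}_{d-1}\bigl(\Delta(\mathcal{P}_{<\alpha});\Bbbk\bigr).$$ (b) In particular, $$\mathcal{B}(I,\Bbbk)=\{\alpha\in\mathcal{P}\mid\widetilde{H}_n\bigl(\Delta(\mathcal{P}_{<\alpha});\Bbbk\bigr)\neq0\text{ for some }n\}.$$ (c) For any $\alpha\in\mathcal{B}(I,\Bbbk)$ the inclusion $\Delta(\mathcal{B}_{<\alpha})\subseteq\Delta(\mathcal{P}_{<\alpha})$ is a homology isomorphism over $\Bbbk$, i.e. it induces isomorphisms on simplicial homology with coefficients in $\Bbbk$.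
   Context: $\mathbb{Z}^m$ is partially ordered coordinatewise. A subposet is a subset with the induced order. $R=\Bbbk[x_1,\dots,x_m]$ carries its standard $\mathbb{Z}^m$-grading. For a multigraded $R$-module $M=\bigoplus_{\alpha\in\mathbb{Z}^m}M_\alpha$, $\deg(M)=\{\alpha\in\mathbb{Z}^m\mid M_\alpha\neq0\}$. The Betti numbers are $\beta_{d,\alpha}(I)=\dim_\Bbbk\operatorname{Tor}^R_d(I,R/\mathfrak{m})_\alpha$ with $\mathfrak{m}=(x_1,\dots,x_m)$, i.e. the number of basis elements of degree $\alpha$ in homological degree $d$ of the minimal free multigraded resolution of $I$ (as an $R$-module). The Betti poset is $\mathcal{B}(I,\Bbbk)=\{\alpha\in\mathbb{Z}^m\mid\beta_{d,\alpha}(I)\ne0\text{ for some }d\}$ with the order induced from $\mathbb{Z}^m$. For a poset $\mathcal{P}$ and $\alpha\in\mathcal{P}$, $\mathcal{P}_{<\alpha}=\{x\in\mathcal{P}\mid x<\alpha\}$. The order complex $\Delta(\mathcal{P})$ is the simplicial complex whose $n$-faces are the strictly increasing chains $a_0<\dots<a_n$ in $\mathcal{P}$. $\widetilde{H}_n(-;\Bbbk)$ denotes reduced simplicial homology, $n\ge-1$, with the convention $\widetilde{H}_{-1}(\Delta(\emptyset);\Bbbk)=\Bbbk$ (and $\widetilde{H}_{-1}=0$ for nonempty posets). *)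

(* Defs.v *)
From HB Require Import structures.
From mathcomp Require Import all_boot all_order all_algebra.
From mathcomp Require Import boolp classical_sets.
From mathcomp Require Import freeg mpoly.

Set Implicit Arguments.
Unset Strict Implicit.
Unset Printing Implicit Defensive.

Import Order.TTheory GRing.Theory Num.Theory.
Local Open Scope ring_scope.
Local Open Scope classical_set_scope.

(* Z^m; [tupleprod] (as opposed to [tuple]) carries the coordinatewise order. *)
Notation Zm m := (m.-tupleprod int).

Definition below disp (T : porderType disp) (P : set T) (a : T) : set T :=
  [set x | P x /\ (x < a)%O].

(* dim_k (Z / B) = n, for B a subspace of the subspace Z of V: there are n
   elements of Z whose classes form a basis of Z / B. *)
Definition quotient_dim (k : fieldType) (V : lmodType k) (Z B : set V)
    (n : nat) : Prop :=
  exists2 b : 'I_n -> V, forall i, Z (b i) &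
    forall z, Z z -> exists! c : 'rV[k]_n, B (z - \sum_(i < n) c 0 i *: b i).

Section OrderComplex.
Variables (k : fieldType) (disp : Order.disp_t) (T : porderType disp).
Implicit Types (P Q : set T) (s : seq T).

(* Faces of the order complex are listed increasingly and indexed by their
   number of vertices, so that the empty face [::] (of dimension -1) is
   treated uniformly. *)
Definition face P (n : nat) : set (seq T) :=
  [set s | [/\ size s = n, sorted <%O s & [set` s] `<=` P]].

Definition chains P (n : nat) : set {freeg (seq T) / k} :=
  [set c | forall s, s \in dom c -> face P n s].

Definition delete_nth (i : nat) s : seq T := take i s ++ drop i.+1 s.

(* The augmented simplicial boundary: a vertex is sent to the empty face. *)
Definition boundary (c : {freeg (seq T) / k}) : {freeg (seq T) / k} :=
  fglift (fun s => \sum_(i < size s) (-1) ^+ i *: << delete_nth i s >>) c.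

(* Reduced homology of the order complex of P in degree n - 1 is
   reduced_cycles P n / boundaries P n. *)
Definition reduced_cycles P (n : nat) : set {freeg (seq T) / k} :=
  [set c | chains P n c /\ boundary c = 0].

Definition boundaries P (n : nat) : set {freeg (seq T) / k} :=
  boundary @` chains P n.+1.

Definition reduced_homology_dim P (n : nat) (r : nat) : Prop :=
  quotient_dim (reduced_cycles P n) (boundaries P n) r.

Definition reduced_homology_nonzero P (n : nat) : Prop :=
  exists2 c, reduced_cycles P n c & ~ boundaries P n c.

(* Unreduced homology in degree n is cycles P n / boundaries P n.+1; every
   0-chain is a cycle. *)
Definition cycles P (n : nat) : set {freeg (seq T) / k} :=
  [set c | chains P n.+1 c /\ (n = 0%N \/ boundary c = 0)].

(* For Q contained in P, the map H_n(Q) -> H_n(P) induced by the inclusion of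
   order complexes is injective and surjective for all n. *)
Definition inclusion_homology_iso Q P : Prop :=
  forall n : nat,
    (forall z, cycles Q n z -> boundaries P n.+1 z -> boundaries Q n.+1 z) /\
    (forall z, cycles P n z ->
       exists2 z', cycles Q n z' & boundaries P n.+1 (z - z')).

End OrderComplex.

Section MonomialIdeals.
Variables (k : fieldType) (m : nat).
Local Notation R := {mpoly k[m]}.
Implicit Types (I : set R) (a : Zm m).

Definition is_ideal I : Prop :=
  [/\ I 0, forall p q, I p -> I q -> I (p + q) & forall p q, I q -> I (p * q)].

Definition is_monomial_ideal I : Prop :=
  exists G : set 'X_{1..m}, I = smallest is_ideal ((fun g => 'X_[g]) @` G).

(* p lies in the component R_a of the Z^m-grading, which is 0 if a has a
   negative coordinate. *)
Definition multihomogeneous (p : R) a : Prop :=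
  forall e, e \in msupp p -> forall i, (e i)%:Z = tnth a i.

Definition deg_set I : set (Zm m) :=
  [set a | exists p, [/\ I p, p != 0 & multihomogeneous p a]].

Definition subZm a b : Zm m := [tuple tnth a i - tnth b i | i < m].

(* An augmented sequence ... -> F_1 -> F_0 -> R of multigraded free modules of
   finite rank, where F_d is the direct sum of the R(- fdeg d j).  Maps act on
   row vectors: the i-th row of a matrix is the image of the i-th basis
   element. *)
Record free_complex := FreeComplex {
  frank : nat -> nat;
  fdeg : forall d, 'I_(frank d) -> Zm m;
  fdiff : forall d, 'M[R]_(frank d.+1, frank d);
  faug : 'cV[R]_(frank 0)
}.
#[global] Arguments fdeg _ {d} _.

Record is_free_resolution (F : free_complex) I : Prop := IsFreeResolution {
  faug_homog : forall i, multihomogeneous (faug F i 0) (fdeg F i);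
  fdiff_homog : forall d i j,
    multihomogeneous (fdiff F d i j) (subZm (fdeg F i) (fdeg F j));
  faug_image : range (fun u : 'rV_(frank F 0) => (u *m faug F) 0 0) = I;
  faug_exact : [set u : 'rV_(frank F 0) | u *m faug F = 0] =
    range (fun v : 'rV_(frank F 1) => v *m fdiff F 0);
  fdiff_exact : forall d,
    [set u : 'rV_(frank F d.+1) | u *m fdiff F d = 0] =
    range (fun v : 'rV_(frank F d.+2) => v *m fdiff F d.+1)
}.

(* The differential of F (x)_R R/(x_1, ..., x_m), where R/(x_1, ..., x_m) is
   identified with k by taking constant coefficients. *)
Definition tensor_diff (F : free_complex) (d : nat) :
    'M[k]_(frank F d.+1, frank F d) := map_mx (mcoeff 0%MM) (fdiff F d).

(* The component of degree a of F_d (x)_R R/(x_1, ..., x_m). *)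
Definition tensor_component (F : free_complex) (d : nat) a :
    set 'rV[k]_(frank F d) :=
  [set v : 'rV_(frank F d) | forall j, fdeg F j != a -> v 0 j = 0].

#[global] Arguments tensor_component _ _ _ _ : clear implicits.

Definition tor_cycles (F : free_complex) (d : nat) a :
    set 'rV[k]_(frank F d) :=
  tensor_component F d a `&`
  match d return set 'rV[k]_(frank F d) with
  | 0 => setT
  | d'.+1 => [set v | v *m tensor_diff F d' = 0]
  end.

Definition tor_boundaries (F : free_complex) (d : nat) a :
    set 'rV[k]_(frank F d) :=
  [set w *m tensor_diff F d | w in tensor_component F d.+1 a].
#[global] Arguments tor_cycles _ _ _ _ : clear implicits.
#[global] Arguments tor_boundaries _ _ _ _ : clear implicits.

(* dim_k Tor_d^R(I, R/(x_1, ..., x_m))_a, computed on some multigraded free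
   resolution of I by free modules of finite rank.  Such a resolution exists
   because R is noetherian, and the dimension does not depend on it. *)
Definition betti I (d : nat) a : nat :=
  xget 0%N [set n | exists2 F, is_free_resolution F I &
                    quotient_dim (tor_cycles F d a) (tor_boundaries F d a) n].

Definition betti_poset I : set (Zm m) := [set a | exists d, betti I d a != 0%N].

End MonomialIdeals.

(* Main.v *)
(* Let D = deg(I) and, for a bound M, let X be the part of D lying in the cube
   [0, M]^m.  By Dickson's lemma, if M is large then every g in D has its
   truncation min(g, M) in X, which is thus the greatest element of X below g.
   Hence the chains of X, with a chain placed in the multidegree of its top
   element, span a multigraded free resolution of I: its strand of degree g is
   the augmented chain complex of a cone.  If M bounds a as well, the component
   of degree a of this resolution tensored with k consists of the chains ending
   in a, so Tor_d(I, k)_a is the reduced homology of D_{<a} in degree d - 1.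
   Multigraded comparison maps and homotopies show that Tor does not depend on
   the resolution.

   For x in D outside P all Betti numbers vanish, so D_{<x} is acyclic.  Adding
   such points x to P one at a time, in increasing order, does not change the
   homology: the chains through x contract by means of a contraction of the
   lower segment.  The same argument applies to the inclusion of the Betti poset
   in P. *)

Require Import Defs.
From HB Require Import structures.
From mathcomp Require Import all_boot all_order all_algebra.
From mathcomp Require Import boolp classical_sets.
From mathcomp Require Import freeg mpoly.
From mathcomp Require Import zify.

Set Implicit Arguments.
Unset Strict Implicit.
Unset Printing Implicit Defensive.

Import Order.TTheory GRing.Theory Num.Theory.

Local Open Scope ring_scope.
Local Open Scope classical_set_scope.

(** * Acyclicity of order complexes *)

Section FreeModule.
Variables (k : fieldType) (K : choiceType).
Local Notation C := {freeg K / k}.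

Lemma freegE (c : C) : c = \sum_(s <- dom c) coeff s c *: << s >>.
Proof.
rewrite -[LHS]freeg_sumE; apply: eq_bigr => s _.
by apply/eqP/freeg_eqP => t; rewrite coeffZ !coeffU mul1r.
Qed.

HB.instance Definition _ (V : lmodType k) (f : K -> V) :=
  GRing.isAdditive.Build C V (fglift f) (lift_is_additive f).

Lemma fglift_scalable (V : lmodType k) (f : K -> V) : scalable (fglift f).
Proof.
move=> a c; rewrite [in LHS]/GRing.scale /= /fgscale raddf_sum [in RHS](freegE c).
rewrite (raddf_sum (fglift f)) scaler_sumr; apply: eq_bigr => s _.
rewrite /= liftU -scalerA; congr (_ *: _).
have -> : coeff s c *: << s >> = << coeff s c *g s >> :> C.
  by apply/eqP/freeg_eqP => t; rewrite coeffZ !coeffU mul1r.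
by rewrite liftU.
Qed.

HB.instance Definition _ (V : lmodType k) (f : K -> V) :=
  GRing.isScalable.Build k C V _ (fglift f) (@fglift_scalable V f).

Lemma fglift1 (V : lmodType k) (f : K -> V) s : fglift f << s >> = f s.
Proof. by rewrite liftU scale1r. Qed.

Lemma fgliftE (V : lmodType k) (f : K -> V) c :
  fglift f c = \sum_(s <- dom c) coeff s c *: f s.
Proof.
rewrite [in LHS](freegE c) linear_sum; apply: eq_bigr => s _.
by rewrite linearZ /= fglift1.
Qed.

Lemma coeff1 s t : coeff s (<< t >> : C) = (t == s)%:R.
Proof. by rewrite coeffU mul1r. Qed.

Lemma eq_linear_freeg (V : lmodType k) (f g : {linear C -> V}) (c : C) :
  (forall s, s \in dom c -> f << s >> = g << s >>) -> f c = g c.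
Proof.
move=> fg; rewrite (freegE c) !linear_sum; apply: eq_big_seq => s sc.
by rewrite !linearZ /= fg.
Qed.

End FreeModule.

(** * Chains of finite lists, their boundary, and concatenation of chains *)

Section Chains.
Variables (k : fieldType) (disp : Order.disp_t) (T : porderType disp).
Local Notation C := {freeg (seq T) / k}.
Implicit Types (P Q : set T) (s t : seq T) (c d : C) (n : nat).

HB.instance Definition _ := GRing.Linear.copy (@boundary k disp T)
  (fglift (fun s => \sum_(i < size s) (-1) ^+ i *: << delete_nth i s >>)).

Lemma chainsP P n c :
  chains P n c <-> forall s, coeff s c != 0 -> face P n s.
Proof. by split=> h s; have := h s; rewrite mem_dom. Qed.

Lemma chains0 P n : chains P n (0 : C).
Proof. by apply/chainsP => s; rewrite coeff0 eqxx. Qed.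

Lemma chainsD P n c d : chains P n c -> chains P n d -> chains P n (c + d).
Proof.
move=> /chainsP hc /chainsP hd; apply/chainsP => s; rewrite coeffD.
by have [c0|/hc //] := eqVneq (coeff s c) 0; rewrite c0 add0r => /hd.
Qed.

Lemma chainsZ P n (a : k) c : chains P n c -> chains P n (a *: c).
Proof.
by move=> /chainsP hc; apply/chainsP => s; rewrite coeffZ mulf_eq0 negb_or => /andP[_ /hc].
Qed.

Lemma chainsB P n c d : chains P n c -> chains P n d -> chains P n (c - d).
Proof. by move=> hc hd; apply: chainsD => //; rewrite -scaleN1r; apply: chainsZ. Qed.

Lemma chains_sum P n (J : Type) (r : seq J) (A : pred J) (F : J -> C) :
  (forall j, A j -> chains P n (F j)) -> chains P n (\sum_(j <- r | A j) F j).
Proof.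
by move=> h; elim/big_ind: _ => //; [exact: chains0|move=> *; exact: chainsD].
Qed.

Lemma chains_face P n s : face P n s -> chains P n (<< s >> : C).
Proof.
move=> hs; apply/chainsP => t; rewrite coeff1.
by case: (s =P t) => [<-|_] /=; rewrite ?eqxx.
Qed.

Lemma sub_face P Q n : P `<=` Q -> face P n `<=` face Q n.
Proof. by move=> PQ s [? ? sP]; split => // x /sP/PQ. Qed.

Lemma sub_chains P Q n : P `<=` Q -> chains P n `<=` (chains Q n : set C).
Proof. by move=> PQ c hc s /hc; apply: sub_face. Qed.

Lemma linear_chains P Q n n' (f : {linear C -> C}) c :
  (forall s, face P n s -> chains Q n' (f << s >>)) ->
  chains P n c -> chains Q n' (f c).
Proof.
move=> fP hc; rewrite (freegE c) linear_sum /= big_seq; apply: chains_sum => s sc.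
by rewrite linearZ; apply/chainsZ/fP/hc.
Qed.

Lemma face_subseq P n n' s t :
  subseq t s -> size t = n' -> face P n s -> face P n' t.
Proof.
move=> ts st [_ so sP]; split => //; first exact: (subseq_sorted lt_trans ts).
by move=> x /= xt; apply: sP => /=; apply: (mem_subseq ts).
Qed.

Lemma face_delete P n s i : face P n.+1 s -> (i < n.+1)%N ->
  face P n (delete_nth i s).
Proof.
move=> hs lein; have [ss _ _] := hs; apply: face_subseq hs.
  rewrite -[X in subseq _ X](cat_take_drop i) /delete_nth cat_subseq//.
  by rewrite -[i.+1]add1n -drop_drop drop_subseq.
rewrite size_cat size_drop size_takel ss; last exact: ltnW.
by rewrite subSS subnKC.
Qed.

Lemma boundary1 s :
  boundary (<< s >> : C) = \sum_(i < size s) (-1) ^+ i *: << delete_nth i s >>.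
Proof. by rewrite /boundary fglift1. Qed.

Lemma boundary_nil : boundary (<< [::] >> : C) = 0.
Proof. by rewrite boundary1 big_ord0. Qed.

Lemma boundary_chains P n c : chains P n.+1 c -> chains P n (boundary c).
Proof.
apply: linear_chains => s hs /=; rewrite boundary1; have [ss _ _] := hs.
apply: chains_sum => i _; apply/chainsZ/chains_face/face_delete => //.
by rewrite -ss.
Qed.

Lemma boundary_chains0 P c : chains P 0 c -> boundary c = 0.
Proof.
move=> hc; rewrite -[RHS](linear0 (@boundary k disp T)).
rewrite [in LHS](freegE c) linear_sum big_seq big1 ?linear0// => s /hc[/size0nil-> _ _].
by rewrite linearZ /= boundary_nil scaler0.
Qed.

Lemma boundary_chains_pred P n c : chains P n c -> chains P n.-1 (boundary c).
Proof.
case: n => [/boundary_chains0->|n]; first exact: chains0.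
exact: boundary_chains.
Qed.

(** Concatenation is formal, with no demand that the result be increasing, so that the identities
    below hold for arbitrary lists and extend linearly. *)
Definition prepend s c : C := fglift (fun t => << s ++ t >>) c.
Definition append t c : C := fglift (fun s => << s ++ t >>) c.
HB.instance Definition _ s := GRing.Linear.copy (prepend s)
  (fglift (fun t => << s ++ t >>)).
HB.instance Definition _ t := GRing.Linear.copy (append t)
  (fglift (fun s => << s ++ t >>)).

Lemma prepend1 s t : prepend s << t >> = << s ++ t >>.
Proof. exact: fglift1. Qed.

Lemma append1 s t : append t << s >> = << s ++ t >>.
Proof. exact: fglift1. Qed.

(** The Leibniz rule for joins: a deleted position lies either in [s] or in [t], and in the second
    case the sign is shifted by the length of [s]. *)
Lemma boundary_cat s t : boundary << s ++ t >> =
  append t (boundary << s >>) + (-1) ^+ size s *: prepend s (boundary << t >>).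
Proof.
rewrite !boundary1 size_cat big_split_ord /= !linear_sum /=.
congr (_ + _); apply: eq_bigr => i _; rewrite !linearZ /= ?append1 ?prepend1.
  rewrite /delete_nth take_cat ltn_ord drop_cat.
  have := ltn_ord i; rewrite leq_eqVlt => /orP[/eqP si|->]; last by rewrite catA.
  by rewrite si ltnn subnn drop0 drop_size cats0.
rewrite scalerA -exprD /delete_nth take_cat drop_cat addnC.
by rewrite ltnNge leq_addl -addSn ltnNge leq_addl /= !addnK catA.
Qed.

Lemma boundary_vertex x : boundary << [:: x] >> = << [::] >> :> C.
Proof. by rewrite boundary1 big_ord1 expr0 scale1r. Qed.

Lemma boundary_prepend1 x c :
  boundary (prepend [:: x] c) = c - prepend [:: x] (boundary c).
Proof.
pose f : {linear C -> C} := @boundary k disp T \o prepend [:: x].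
pose g : {linear C -> C} := idfun \- (prepend [:: x] \o @boundary k disp T).
apply: (@eq_linear_freeg _ _ _ f g) => s _ /=.
rewrite prepend1 boundary_cat /= expr1 scaleN1r; congr (_ + _).
by rewrite boundary_vertex append1.
Qed.

(** Both sides are the bilinear concatenation of [c] with [d], expanded first in one argument or
    first in the other. *)
Lemma fglift_append_prepend c d :
  fglift (append^~ c) d = fglift (prepend^~ d) c.
Proof.
rewrite !fgliftE; under eq_bigr => t _ do rewrite /append fgliftE scaler_sumr.
rewrite exchange_big; apply: eq_bigr => s _ /=.
rewrite /prepend fgliftE scaler_sumr; apply: eq_bigr => t _.
by rewrite !scalerA mulrC.
Qed.

(** Induction on the length of a list: by [boundary_prepend1], two boundaries of [x :: s] leave [x]
    prepended to two boundaries of [s]. *)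
Lemma boundaryK c : boundary (boundary c) = 0.
Proof.
pose f : {linear C -> C} := @boundary k disp T \o @boundary k disp T.
apply: (@eq_linear_freeg _ _ _ f \0) => s _ /=; elim: s => [|x s IH].
  by rewrite boundary_nil linear0.
rewrite -(prepend1 [:: x]) boundary_prepend1 linearB /= boundary_prepend1 IH.
by rewrite linear0 subr0 subrr.
Qed.

End Chains.

Section Acyclicity.
Variables (k : fieldType) (disp : Order.disp_t) (T : porderType disp).
Local Notation C := {freeg (seq T) / k}.
Implicit Types (P Q : set T) (s t : seq T) (c d : C) (n : nat).

(** The case [n = 0] is included: it concerns the empty face and makes an acyclic set nonempty. *)
Definition acyclic P := forall n, reduced_cycles P n `<=` (boundaries P n : set C).

(* For Q contained in P, the vanishing of the homology of the pair (P, Q); the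
   predecessor is harmless since the boundary of a chain of empty faces is 0. *)
Definition relatively_acyclic Q P := forall n (c : C), chains P n c ->
  chains Q n.-1 (boundary c) ->
  exists2 e, chains P n.+1 e & chains Q n (c - boundary e).

Lemma eq_linear_chains (V : lmodType k) (f g : {linear C -> V}) P n c :
  (forall s, face P n s -> f << s >> = g << s >>) -> chains P n c -> f c = g c.
Proof. by move=> fg hc; apply: eq_linear_freeg => s /hc/fg. Qed.

Lemma eq_fglift (V : lmodType k) (f g : seq T -> V) P n c :
  (forall s, face P n s -> f s = g s) -> chains P n c -> fglift f c = fglift g c.
Proof.
by move=> fg hc; rewrite !fgliftE; apply: eq_big_seq => s /hc/fg ->.
Qed.

Lemma signrMK (V : lmodType k) n (v : V) : (-1) ^+ n *: ((-1) ^+ n *: v) = v.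
Proof. by rewrite scalerA -expr2 sqrr_sign scale1r. Qed.

(** * Posets with a greatest element *)

Section Cone.
Variables (P : set T) (w : T) (Pw : P w) (maxw : forall x, P x -> (x <= w)%O).

(** The cone with apex [w] placed last; the sign makes it a contraction for [boundary] without
    further correction. *)
Definition cone : C -> C :=
  fglift (fun s => if w \in s then 0 else (-1) ^+ size s *: << rcons s w >>).
HB.instance Definition _ := GRing.Linear.copy cone (fglift _).

Lemma cone_in s : w \in s -> cone << s >> = 0.
Proof. by move=> ws; rewrite /cone fglift1 ws. Qed.

Lemma cone_notin s : w \notin s -> cone << s >> = (-1) ^+ size s *: << rcons s w >>.
Proof. by move=> ws; rewrite /cone fglift1 (negPf ws). Qed.

Lemma face_rcons n s : face P n s -> w \notin s -> face P n.+1 (rcons s w).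
Proof.
move=> [ss so sP] ws; split; first by rewrite size_rcons ss.
  case: s so ws sP {ss} => [//|x s] /= so ws sP; rewrite rcons_path so /=.
  rewrite lt_neqAle maxw ?andbT; last by apply: sP; rewrite /= mem_last.
  by apply: contra ws => /eqP <-; apply: mem_last.
by move=> x /=; rewrite mem_rcons inE => /orP[/eqP->//|]; apply: sP.
Qed.

Lemma face_max n s : face P n s -> w \in s ->
  exists s', s = rcons s' w /\ w \notin s'.
Proof.
case/lastP: s => // s x [_ so sP] ws; exists s.
have [xw|xw] := eqVneq x w.
  split; first by rewrite xw.
  have := sorted_uniq lt_trans (@lt_irreflexive _ _) so.
  by rewrite rcons_uniq xw => /andP[].
have /maxw xlew : P x by apply: sP => /=; rewrite mem_rcons mem_head.
move: ws; rewrite mem_rcons inE eq_sym (negPf xw) /= => ws.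
have := so; rewrite (sorted_pairwise lt_trans) -cats1 pairwise_cat.
move=> /andP[/allrelP/(_ w x ws (mem_head _ _)) wx _].
by have := lt_le_trans wx xlew; rewrite ltxx.
Qed.

Lemma cone_append n c : chains [set x | P x /\ x <> w] n c ->
  cone c = (-1) ^+ n *: append [:: w] c.
Proof.
pose g : {linear C -> C} := (-1) ^+ n \*: append [:: w].
apply: (@eq_linear_chains _ cone g) => s [ss _ sP] /=.
rewrite append1 cats1 cone_notin ?ss//; apply/negP => ws.
by have [] := sP w ws.
Qed.

Lemma cone_homotopy n c : chains P n c ->
  boundary (cone c) + cone (boundary c) = c.
Proof.
pose f : {linear C -> C} :=
  (@boundary k disp T \o cone) \+ (cone \o @boundary k disp T).
apply: (@eq_linear_chains _ f idfun) => s hs /=.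
have Pw' s' n' : face P n' s' -> w \notin s' ->
    face [set x | P x /\ x <> w] n' s'.
  move=> [? ? sP] ws; split => // x /= xs; split; first exact: sP.
  by move=> xw; rewrite -xw xs in ws.
case: (boolP (w \in s)) => [ws|ws].
  (* All terms of the boundary of [s] except [s'] still contain [w], so [cone] kills them; the cone
     over [s'] gives back [s]. *)
  have [s' [def_s ws']] := face_max hs ws; rewrite cone_in// linear0 add0r def_s.
  rewrite -cats1 boundary_cat linearD linearZ /= boundary_vertex.
  rewrite prepend1 cats0 cone_notin// signrMK cats1.
  set g := _ (append _ _); suff -> : g = 0 by rewrite add0r.
  pose u : {linear C -> C} := cone \o append [:: w].
  apply: (@eq_linear_freeg _ _ _ u \0) => t _ /=.
  by rewrite append1 cone_in// mem_cat mem_head orbT.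
(* Deleting [w] from the cone gives back [s]; the other terms cancel against the cone over the
   boundary, whose faces are one shorter and so carry the opposite sign. *)
rewrite cone_notin// linearZ /= -cats1 boundary_cat scalerDr signrMK.
rewrite boundary_vertex prepend1 cats0.
case: n hs => [[/size0nil-> _ _]|n hs].
  by rewrite boundary_nil !linear0 add0r addr0.
have [ss _ _] := hs.
rewrite (@cone_append n); last by apply/boundary_chains/chains_face/Pw'.
by rewrite ss exprS mulN1r scaleNr addrAC addNr add0r.
Qed.

Lemma acyclic_max : acyclic P.
Proof.
move=> n c [hc c0]; exists (cone c); last first.
  by have := cone_homotopy hc; rewrite c0 linear0 addr0.
apply: linear_chains hc => s hs /=; have [ss _ _] := hs.
case: (boolP (w \in s)) => ws; first by rewrite cone_in//; apply: chains0.
by rewrite cone_notin//; apply/chainsZ/chains_face/face_rcons.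
Qed.

End Cone.

Lemma boundary_append P n t c : chains P n c ->
  boundary (append t c) = append t (boundary c) +
    (-1) ^+ n *: fglift (fun t' => append t' c) (boundary << t >>).
Proof.
move=> hc; pose f : {linear C -> C} := @boundary k disp T \o append t.
pose j : {linear C -> C} := fglift (fun s => prepend s (boundary << t >>)).
pose g : {linear C -> C} :=
  (append t \o @boundary k disp T) \+ ((-1) ^+ n \*: j).
rewrite fglift_append_prepend -/(j c).
apply: (@eq_linear_chains _ f g) hc => s [ss _ _] /=.
by rewrite append1 boundary_cat /j fglift1 ss.
Qed.


(** * Removing a point whose lower segment is acyclic *)

Section RemoveVertex.
Variables (P : set T) (x : T).
Hypothesis acx : acyclic (below P x).
Local Notation Q := [set y | P y /\ y <> x].

(** A contracting homotopy built by recursion on length: once [h] is known on shorter faces,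
    [<< s >> - h (boundary << s >>)] is a cycle, and [h s] is chosen as a chain that it bounds. *)
Lemma contraction : exists h : seq T -> C, forall n s, face (below P x) n s ->
  chains (below P x) n.+1 (h s) /\ 
  boundary (h s) = << s >> - fglift h (boundary << s >>).
Proof.
(* The default 0 can arise only when [c] does not bound; [pickP] excludes this for cycles. *)
pose pick n c := xget 0 [set e | chains (below P x) n.+1 e /\ boundary e = c].
have pickP n c : reduced_cycles (below P x) n c ->
    chains (below P x) n.+1 (pick n c) /\ boundary (pick n c) = c.
  move=> /acx[e he ec].
  apply: (@xgetPex _ 0 [set e | chains (below P x) n.+1 e /\ boundary e = c]).
  by exists e.
(* The recursion runs on the length, since the boundary of [s] involves lists that are not
   structural subterms of [s]. *)
pose hs := fix hs (n : nat) (s : seq T) : C := pick n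
  (if n is n'.+1 then << s >> - fglift (hs n') (boundary << s >>) else << s >>).
exists (fun s => hs (size s) s) => n s; elim: n s => [|n IH] s hs_.
  have [ss _ _] := hs_; rewrite ss /=; move/size0nil: (ss) => s0.
  rewrite s0 boundary_nil linear0 subr0; apply: pickP.
  by split; [apply: chains_face; rewrite -s0|exact: boundary_nil].
have [ss _ _] := hs_; rewrite ss.
have bs : chains (below P x) n (boundary << s >> : C).
  exact/boundary_chains/chains_face.
have -> : fglift (fun s => hs (size s) s) (boundary << s >>) =
    fglift (hs n) (boundary << s >>).
  by apply: eq_fglift bs => t [<- _ _].
apply: pickP; split.
  apply: chainsB; first exact: chains_face.
  apply: (linear_chains (f := fglift (hs n))) bs => t ht /=; rewrite fglift1.
  by have [] := IH t ht; have [-> _ _] := ht.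
rewrite linearB /=.
pose f : {linear C -> C} := @boundary k disp T \o fglift (hs n).
pose g : {linear C -> C} :=
  idfun \- (fglift (fun s => hs (size s) s) \o @boundary k disp T).
have -> : boundary (fglift (hs n) (boundary << s >>)) =
    g (boundary << s >>).
  apply: (@eq_linear_chains _ f g) bs => t ht /=; rewrite fglift1.
  by have [_] := IH t ht; have [-> _ _] := ht.
by rewrite /g /= boundaryK linear0 subr0 subrr.
Qed.

Lemma face_cat n n' s t : face (below P x) n s -> face P n' t ->
  (forall z, z \in t -> (x <= z)%O) -> face P (n + n') (s ++ t).
Proof.
move=> [ss so sP] [st to tP] xt; split; first by rewrite size_cat ss st.
  rewrite (sorted_pairwise lt_trans) pairwise_cat -!(sorted_pairwise lt_trans).
  rewrite so to !andbT; apply/allrelP => u v us /xt; apply: lt_le_trans.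
  by have [] := sP u us.
by move=> z /=; rewrite mem_cat => /orP[/sP[]|/tP].
Qed.

(* H maps s1 ++ x :: t to h s1 ++ x :: t and kills the chains avoiding x.  Up to
   chains avoiding x, it is a homotopy between the identity and 0. *)
Lemma relatively_acyclic_remove : relatively_acyclic Q P.
Proof.
have [h hP] := contraction.
(* The list is cut at the first occurrence of [x]; on a face this is the only one. *)
have [H [H_notin H_in]] : exists H : {linear C -> C},
    (forall s, x \notin s -> H << s >> = 0) /\
    (forall s t, x \notin s -> H << s ++ x :: t >> = append (x :: t) (h s)).
  exists (fglift (fun s => if x \in s then
    append (drop (index x s) s) (h (take (index x s) s)) else 0)).
  split=> [s xs|s t xs] /=; rewrite fglift1; first by rewrite (negPf xs).
  rewrite mem_cat mem_head orbT index_cat (negPf xs) /= eqxx addn0.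
  by rewrite drop_size_cat// take_size_cat.
have split n s : face P n s -> x \in s -> exists s1 t, [/\ s = s1 ++ x :: t,
    x \notin s1, x \notin t, face (below P x) (size s1) s1 &
    forall z, z \in t -> (x <= z)%O].
  move=> [ss so sP] xs; have us := sorted_uniq lt_trans (@lt_irreflexive _ _) so.
  case/splitPr: xs => s1 t in ss so sP us *; exists s1, t.
  move: us; rewrite cat_uniq /= negb_or => /and3P[_ /andP[xs1 _] /andP[xt _]].
  move: so; rewrite (sorted_pairwise lt_trans) pairwise_cat /=.
  move=> /and4P[/allrelP st s1so /allP xlt _]; split => //.
  - split => //; first by rewrite (sorted_pairwise lt_trans).
    move=> y ys1; split; first by apply: sP; rewrite /= mem_cat ys1.
    by apply: st => //; apply: mem_head.
  - by move=> z /xlt /ltW.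
(* Chains avoiding [x] are killed by [H]; this disposes of the boundary of a relative cycle at the
   end. *)
have HQ n (c : C) : chains Q n c -> H c = 0.
  move=> hc; rewrite (freegE c) linear_sum big_seq big1// => s /hc[_ _ sQ].
  by rewrite linearZ /= H_notin ?scaler0//; apply/negP => /sQ[].
pose G : {linear C -> C} :=
  idfun \- (@boundary k disp T \o H) \- (H \o @boundary k disp T).
have GQ n s : face P n s -> chains Q n (G << s >>).
  move=> sn; have [xs|xs] := boolP (x \in s); last first.
    have sQ : face Q n s.
      have [? ? sP] := sn; split => // y ys; split; first exact: sP.
      by move=> yx; rewrite -yx ys in xs.
    rewrite /G /= H_notin// linear0 subr0 (HQ n.-1) ?subr0; first exact: chains_face.
    exact/boundary_chains_pred/chains_face.
  have [s1 [t [def_s xs1 xt s1P tx]]] := split _ _ sn xs.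
  have [hs1 bhs1] := hP _ _ s1P.
  pose J : {linear C -> C} :=
    fglift (fun t' => append t' (h s1)) \o prepend [:: x].
  have bt : boundary << x :: t >> =
      << t >> - prepend [:: x] (boundary << t >>) :> C.
    by rewrite -(prepend1 _ [:: x]) boundary_prepend1.
  have H_append n' d : chains (below P x) n' d ->
      H (append (x :: t) d) = append (x :: t) (fglift h d).
    apply: (@eq_linear_chains _ (H \o append (x :: t)) (append (x :: t) \o fglift h)).
    move=> s' [_ _ s'P] /=; rewrite append1 fglift1 H_in//.
    by apply/negP => /s'P[_]; rewrite ltxx.
  have H_prepend d : H (prepend s1 (prepend [:: x] d)) = J d.
    apply: (@eq_linear_freeg _ _ _ (H \o (prepend s1 \o prepend [:: x])) J).
    by move=> s' _; rewrite /J /= !prepend1 H_in// fglift1.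
  have bHs : boundary (H << s >>) =
      << s >> - append (x :: t) (fglift h (boundary << s1 >>)) -
      (-1) ^+ size s1 *: (append t (h s1) - J (boundary << t >>)).
    rewrite def_s H_in// (boundary_append _ hs1) bhs1 bt exprS mulN1r scaleNr.
    by rewrite !linearB /= append1 fglift1.
  have Hbs : H (boundary << s >>) =
      append (x :: t) (fglift h (boundary << s1 >>)) -
      (-1) ^+ size s1 *: J (boundary << t >>).
    rewrite def_s boundary_cat bt linearD linearZ /= linearB /= linearB /=.
    rewrite H_prepend prepend1 H_notin ?mem_cat ?negb_or ?xs1// sub0r scalerN.
    by rewrite (H_append _ _ (boundary_chains_pred (chains_face s1P))).
  (* All terms through [x] cancel except the one where the boundary deletes [x] from
     [h s1 ++ x :: t]; it avoids [x]. *)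
  have eG : G << s >> = (-1) ^+ size s1 *: append t (h s1).
    rewrite /G /= bHs Hbs scalerBr !opprD !opprK !addrA subrr add0r.
    by rewrite [X in X - _ - _ + _]addrC [X in X + _]addrAC addrK subrK.
  apply: (eq_ind_r (chains Q n) _ eG).
  have eqn : n = (size s1 + (size t).+1)%N.
    by have [<- _ _] := sn; rewrite def_s size_cat.
  apply: chainsZ; apply: linear_chains hs1 => s' hs' /=; rewrite append1.
  have tP : face P (size t) t.
    apply: face_subseq sn => //; rewrite def_s -cat_rcons; exact: suffix_subseq.
  apply: chains_face; rewrite eqn addnS -addSn.
  have [? ? h'] := face_cat hs' tP tx; split => // z zs; split; first exact: h'.
  move=> zx; move: zs; rewrite /= zx mem_cat (negPf xt) orbF.
  by have [_ _ s'P] := hs' => /s'P[_]; rewrite ltxx.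
move=> n c hc bc; exists (H c).
  apply: linear_chains hc => s sn /=.
  have [xs|xs] := boolP (x \in s); last by rewrite H_notin//; apply: chains0.
  have [s1 [t [def_s xs1 xt s1P tx]]] := split _ _ sn xs.
  rewrite def_s H_in//; have [hs1 _] := hP _ _ s1P.
  apply: linear_chains hs1 => s' hs' /=; rewrite append1.
  have -> : n.+1 = ((size s1).+1 + (size t).+1)%N.
    by have [<- _ _] := sn; rewrite def_s size_cat.
  apply/chains_face/face_cat => //; last first.
    by move=> z; rewrite inE => /orP[/eqP->//|/tx].
  by apply: face_subseq sn => //; rewrite def_s; exact: suffix_subseq.
(* The boundary of [c] avoids [x], so the third term of [G c] vanishes. *)
have <- : G c = c - boundary (H c) by rewrite /G /= (HQ _ _ bc) subr0.
by apply: (linear_chains (f := G)) hc => s; apply: GQ.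
Qed.

End RemoveVertex.

(** A chain is pushed first into [Q'] and then into [Q]. The first correction is a boundary, so it
    leaves the boundary of the chain in [Q]. *)
Lemma relatively_acyclic_trans Q' Q P : Q `<=` Q' -> Q' `<=` P ->
  relatively_acyclic Q Q' -> relatively_acyclic Q' P -> relatively_acyclic Q P.
Proof.
move=> QQ' Q'P r r' n c hc bc.
have [e he ce] := r' n c hc (sub_chains QQ' bc).
have [|e' he' ce'] := r n _ ce; first by rewrite linearB /= boundaryK subr0.
exists (e + e'); first by apply: chainsD => //; exact: sub_chains he'.
by rewrite linearD /= opprD addrA.
Qed.

(** Choose [x] in [A] with the fewest entries of [l] strictly below it: for [y < x] the entries
    below [y] are among those below [x] and miss [y] itself. *)
Lemma minimal_mem (A : set T) (l : seq T) : (exists2 x, x \in l & A x) ->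
  exists x, [/\ x \in l, A x & forall y, y \in l -> A y -> ~ (y < x)%O].
Proof.
move=> [x0 x0l Ax0].
pose N x := count (fun y => (y < x)%O) l.
pose R := [pred n | `[< exists x, [/\ x \in l, A x & N x = n] >]].
have exR : exists n, R n by exists (N x0); apply/asboolP; exists x0.
have [n /asboolP[x [xl Ax Nx]] minn] := ex_minnP exR.
exists x; split => // y yl Ay yx.
suff : (N y < N x)%N.
  by rewrite Nx ltnNge => /negP; apply; apply: minn; apply/asboolP; exists y.
rewrite /N -!size_filter.
have sub : subseq [seq z <- l | (z < y)%O] [seq z <- l | (z < x)%O].
  rewrite (_ : [seq z <- l | (z < y)%O] =
               [seq z <- [seq z <- l | (z < x)%O] | (z < y)%O]).
    exact: filter_subseq.
  rewrite -filter_predI; apply: eq_filter => z /=.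
  by have [zy|//] := boolP (z < y)%O; rewrite /= (lt_trans zy yx).
rewrite ltn_neqAle size_subseq// andbT; apply/negP => /eqP eqs.
have : y \in [seq z <- l | (z < x)%O] by rewrite mem_filter yx yl.
move: (size_subseq_leqif sub) => [_]; rewrite eqs eqxx => /esym/eqP <-.
by rewrite mem_filter ltxx.
Qed.

(** Induction on a list containing [P] minus [Q]. A minimal point [x] of the difference is added to
    [Q]; by minimality its lower segment in the enlarged set is already the full one in [P], hence
    acyclic. *)
Lemma acyclic_relatively Q P (l : seq T) : Q `<=` P ->
  (forall x, P x -> ~ Q x -> x \in l) ->
  (forall x, P x -> ~ Q x -> acyclic (below P x)) -> relatively_acyclic Q P.
Proof.
move=> QP finP acP; move: {2}(size l) (leqnn (size l)) => N.
elim: N l Q QP finP acP => [|N IH] l Q QP finP acP lN.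
  move=> n c hc _; exists 0; first exact: chains0.
  rewrite linear0 subr0; apply: sub_chains hc => x Px.
  apply: contrapT => /finP -/(_ Px); by case: l lN {finP}.
have [[x xl [Px Qx]]|noex] := pselect (exists2 x, x \in l & P x /\ ~ Q x); last first.
  (* Nothing in [l] lies in the difference, so the difference is empty and the empty list contains
     it. *)
  apply: (IH [::]) => // x Px Qx; case: noex; exists x => //; exact: finP.
have [|{Px Qx xl}x [xl [Px Qx] minx]] := @minimal_mem (fun x => P x /\ ~ Q x) l.
  by exists x.
pose Q' := [set y | Q y \/ y = x].
have Q'x : below Q' x = below P x.
  apply/seteqP; split=> y [Hy yx]; split => //.
    by case: Hy => [/QP//|->].
  left; apply: contrapT => Qy; exact: (minx y (finP _ Hy Qy)).
have eQ : [set y | Q' y /\ y <> x] = Q.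
  apply/seteqP; split=> y; first by move=> [[//|->]].
  by move=> Qy; split; [left|move=> yx; rewrite yx in Qy].
have QQ' : Q `<=` Q' by move=> y; left.
have Q'P : Q' `<=` P by move=> y [/QP//|->].
apply: (relatively_acyclic_trans QQ' Q'P).
  by rewrite -{1}eQ; apply: relatively_acyclic_remove; rewrite Q'x; apply: acP.
apply: (IH (rem x l)) => //.
- move=> y Py Q'y; have yx : y != x by apply/eqP => yx; apply: Q'y; right.
  by apply: rem_mem => //; apply: finP => // Qy; apply: Q'y; left.
- by move=> y Py Q'y; apply: acP => // Qy; apply: Q'y; left.
- by rewrite size_rem// -subn1 leq_subLR add1n.
Qed.

Section RelativelyAcyclic.
Variables (Q P : set T) (QP : Q `<=` P) (r : relatively_acyclic Q P).

(** If [e] in [P] has boundary [c] in [Q], then [e] is a relative cycle; moving it into [Q] by a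
    boundary keeps its own boundary [c]. *)
Lemma relatively_acyclic_inj n c : chains Q n c ->
  boundaries P n c -> boundaries Q n c.
Proof.
move=> hc [e he ec]; have [|e' he' ee'] := r he; first by rewrite ec.
by exists (e - boundary e'); rewrite // linearB /= boundaryK subr0.
Qed.

Lemma relatively_acyclic_surj n c : chains P n c -> chains Q n.-1 (boundary c) ->
  exists2 c', chains Q n c' & boundary c' = boundary c /\ boundaries P n (c - c').
Proof.
move=> hc bc; have [e he ce] := r hc bc; exists (c - boundary e) => //.
by rewrite linearB /= boundaryK subr0 opprB addrC subrK; split=> //; exists e.
Qed.

Lemma relatively_acyclic_homology_iso : inclusion_homology_iso k Q P.
Proof.
move=> n; split=> z [hz bz]; first exact: relatively_acyclic_inj.
(* In degree 0 the augmented boundary may be nonzero, but it is a multiple of the empty face, which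
   is a face over [Q] too. *)
have bQ : chains Q n.+1.-1 (boundary z).
  case: bz hz => [->|->] hz; last exact: chains0.
  by move=> s /(boundary_chains hz)[/size0nil-> _ _]; split.
have [z' hz' [bz' zz']] := relatively_acyclic_surj hz bQ; exists z' => //.
by split=> //; case: bz => [->|<-]; [left|right].
Qed.

End RelativelyAcyclic.

End Acyclicity.

(** * Dimensions of subquotients *)

Section QuotientDim.
Variable k : fieldType.

Definition submodule (V : lmodType k) (S : set V) :=
  S 0 /\ forall (a : k) u v, S u -> S v -> S (a *: u + v).

Section Submodule.
Variables (V : lmodType k) (S : set V) (subS : submodule S).

Lemma submoduleD u v : S u -> S v -> S (u + v).
Proof. by move=> Su Sv; rewrite -[u]scale1r; apply: subS.2. Qed.

Lemma submoduleZ a u : S u -> S (a *: u).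
Proof. by move=> Su; rewrite -[_ *: _]addr0; apply: subS.2 => //; exact: subS.1. Qed.

Lemma submoduleB u v : S u -> S v -> S (u - v).
Proof. by move=> Su Sv; apply: submoduleD => //; rewrite -scaleN1r; apply: submoduleZ. Qed.

Lemma submodule_sum (J : finType) (F : J -> V) :
  (forall j, S (F j)) -> S (\sum_j F j).
Proof. by move=> SF; elim/big_ind: _ => //; [exact: subS.1|exact: submoduleD]. Qed.

End Submodule.

(** The hypotheses say that [f] induces an isomorphism from [Z' / B'] to [Z / B], along which a
    basis is lifted. *)
Lemma quotient_dim_pull (V V' : lmodType k) (f : {linear V' -> V})
    (Z B : set V) (Z' B' : set V') n : submodule B -> submodule Z' ->
  Z' `<=` f @^-1` Z -> B' `<=` f @^-1` B ->
  (forall z, Z' z -> B (f z) -> B' z) ->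
  (forall z, Z z -> exists2 z', Z' z' & B (z - f z')) ->
  quotient_dim Z B n -> quotient_dim Z' B' n.
Proof.
move=> subB subZ' ZZ BB inj surj [b bZ bP].
have /choice[b' b'P] i : exists z', Z' z' /\ B (b i - f z').
  by have [z' ? ?] := surj _ (bZ i); exists z'.
(* The lifts [b'] match [b] only modulo [B]; the accumulated error stays in [B]. *)
have eqB z' (c : 'rV_n) : B (f z' - \sum_i c 0 i *: b i) <->
    B (f (z' - \sum_i c 0 i *: b' i)).
  have Bd : B (\sum_i c 0 i *: (b i - f (b' i))).
    by apply: submodule_sum => // i; apply: submoduleZ => //; case: (b'P i).
  have -> : f (z' - \sum_i c 0 i *: b' i) = f z' - \sum_i c 0 i *: b i +
      \sum_i c 0 i *: (b i - f (b' i)).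
    rewrite linearB linear_sum -addrA; congr (_ + _).
    rewrite -!sumrN -big_split; apply: eq_bigr => i _ /=.
    by rewrite linearZ scalerBr addKr.
  split=> Bu; first exact: submoduleD.
  set u := (X in B X); rewrite (_ : u = u + \sum_i c 0 i *: (b i - f (b' i)) -
    \sum_i c 0 i *: (b i - f (b' i))); first exact: submoduleB.
  by rewrite addrK.
exists b' => [i|z' Zz']; first by case: (b'P i).
have [c [Bc unic]] := bP _ (ZZ _ Zz'); exists c; split.
  apply: inj; last exact/eqB.
  apply: submoduleB => //; apply: submodule_sum => // i.
  by apply: submoduleZ => //; case: (b'P i).
by move=> c' B'c'; apply/unic/eqB/BB.
Qed.

Lemma quotient_dim_eq0 (V : lmodType k) (Z B : set V) n : B 0 ->
  quotient_dim Z B n -> n = 0%N <-> Z `<=` B.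
Proof.
move=> B0 [b bZ bP]; split=> [n0 z Zz|ZB].
  have [c [Bc _]] := bP z Zz; subst n.
  by move: Bc; rewrite big_ord0 subr0.
(* If [n] were positive, both 0 and the first unit vector would be coordinates of the first basis
   element, against uniqueness. *)
case: n b bZ bP => // n b bZ bP.
have [c [_ unic]] := bP _ (bZ ord0).
have c0 : c = 0.
  apply: unic; rewrite big1 ?subr0 => [|i _]; first exact: ZB.
  by rewrite mxE scale0r.
have c1 : c = delta_mx 0 0.
  apply: unic; rewrite (bigD1 ord0)//= mxE !eqxx scale1r big1 ?addr0 ?subrr//.
  by move=> i /negPf i0; rewrite mxE i0 scale0r.
have /matrixP/(_ 0 0) := c1; rewrite c0 !mxE !eqxx => /eqP.
by rewrite eq_sym oner_eq0.
Qed.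

(** Take a longest family in [Z] independent modulo [B]. Such a family is linearly independent, so
    its length is at most [N], and maximality makes it span. *)
Lemma quotient_dim_exists N (Z B : set 'rV[k]_N) : submodule Z -> submodule B ->
  exists n, quotient_dim Z B n.
Proof.
move=> subZ subB.
pose indep n (b : 'M[k]_(n, N)) := (forall i, Z (row i b)) /\
  forall c : 'rV_n, B (c *m b) -> c = 0.
pose R := [pred n | `[< exists b : 'M_(n, N), indep n b >]].
have exR : exists n, R n.
  exists 0%N; apply/asboolP; exists 0.
  by split=> [[]//|c _]; apply/rowP => -[].
have boundR n : R n -> (n <= N)%N.
  move=> /asboolP[b [_ bB]]; suff /eqP <- : row_free b by exact: rank_leq_col.
  by apply: inj_row_free => v vb; apply: bB; rewrite vb; exact: subB.1.
have [n /asboolP[b [bZ bB]] maxn] := ex_maxnP exR boundR.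
have combE (c : 'rV_n) : \sum_i c 0 i *: row i b = c *m b by rewrite mulmx_sum_row.
exists n, (fun i => row i b) => // z Zz.
have [c Bc] : exists c, B (z - c *m b).
  apply: contrapT => noc; suff : R n.+1 by move/maxn; rewrite ltnn.
  have zbZ (i : 'I_(1 + n)) : Z (row i (col_mx z b)).
    rewrite -(splitK i); case: (split i) => j /=; last by rewrite rowKd.
    by rewrite rowKu ord1; have -> : row 0 z = z by apply/rowP => l; rewrite mxE.
  have zbB (c : 'rV_(1 + n)) : B (c *m col_mx z b) -> c = 0.
    rewrite -(hsubmxK c) mul_row_col.
    move: (lsubmx _) (rsubmx _) => a c'; rewrite [a]mx11_scalar mul_scalar_mx.
    have [->|a0] := eqVneq (a 0 0) 0.
      by rewrite scale0r add0r => /bB ->; rewrite raddf0 row_mx0.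
    (* A nonzero coefficient of [z] could be divided out, expressing [z] through [b] modulo [B]. *)
    move=> /(submoduleZ subB (a 0 0)^-1); rewrite scalerDr scalerA mulVf// scale1r.
    move=> Bz; case: noc; exists (- ((a 0 0)^-1 *: c')).
    by rewrite mulNmx opprK -scalemxAl.
  by apply/asboolP; exists (col_mx z b : 'M_(1 + n, N)).
exists c; split=> [|c']; first by rewrite [X in _ - X]combE.
rewrite [X in _ - X]combE => Bc'.
apply/eqP; rewrite -subr_eq0; apply/eqP/bB.
have := submoduleB subB Bc' Bc.
by rewrite mulmxBl opprB addrC addrA subrK.
Qed.

End QuotientDim.

(** * Multigraded polynomials and matrices *)

Section Multigrading.
Variables (k : fieldType) (m : nat).
Local Notation R := {mpoly k[m]}.
Implicit Types (p q : R) (a b c : Zm m) (e f : 'X_{1..m}).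

Definition mnm_deg e : Zm m := [tuple (e i)%:Z | i < m].

(** A total inverse of [mnm_deg], faithful only on degrees without negative coordinates. *)
Definition abs_mnm a : 'X_{1..m} := [multinom absz (tnth a i) | i < m].

Lemma mnm_degE e i : tnth (mnm_deg e) i = (e i)%:Z.
Proof. exact: tnth_mktuple. Qed.

Lemma subZmE a b i : tnth (subZm a b) i = tnth a i - tnth b i.
Proof. exact: tnth_mktuple. Qed.

Lemma eqZmP a b : a = b <-> forall i, tnth a i = tnth b i.
Proof. by split=> [->//|ab]; apply: eq_from_tnth. Qed.

Lemma multihomogeneousP p a :
  multihomogeneous p a <-> forall e, p@_e != 0 -> mnm_deg e = a.
Proof.
split=> h e pe.
  by apply/eqZmP => i; rewrite mnm_degE; apply: h; rewrite mcoeff_msupp.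
by move=> i; rewrite -mnm_degE; congr tnth; apply: h; rewrite -mcoeff_msupp.
Qed.

Lemma subZm0 a : subZm a (mnm_deg 0) = a.
Proof. by apply/eqZmP => i; rewrite subZmE mnm_degE mnm0E subr0. Qed.

Lemma mnm_degD e f a : (mnm_deg (e + f) == a) = (mnm_deg e == subZm a (mnm_deg f)).
Proof.
apply/eqP/eqP => [<-|/eqZmP ef]; apply/eqZmP => i.
  by rewrite subZmE !mnm_degE mnmDE PoszD addrK.
by have := ef i; rewrite subZmE !mnm_degE mnmDE PoszD => ->; rewrite subrK.
Qed.

Lemma subZmDD a b c e f : mnm_deg e = subZm a b -> mnm_deg f = subZm b c ->
  mnm_deg (e + f) = subZm a c.
Proof.
move=> /eqZmP ea /eqZmP fb; apply/eqZmP => i; move: (ea i) (fb i).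
by rewrite !subZmE !mnm_degE mnmDE PoszD => -> ->; rewrite addrA subrK.
Qed.

Definition hpart a p : R := \sum_(e <- msupp p | mnm_deg e == a) p@_e *: 'X_[e].

Lemma mcoeff_hpart a p e : (hpart a p)@_e = if mnm_deg e == a then p@_e else 0.
Proof.
rewrite /hpart raddf_sum /=.
under eq_bigr do rewrite mcoeffZ mcoeffX.
have [ep|ep] := boolP (e \in msupp p); last first.
  rewrite memN_msupp_eq0// if_same big_seq_cond big1// => f /andP[fp _].
  by case: eqP fp ep => [->->|]; rewrite ?mulr0.
rewrite big_mkcond (bigD1_seq e)//= eqxx mulr1 big1 ?addr0// => f /negPf fe.
by rewrite fe mulr0 if_same.
Qed.

Lemma hpart_is_linear a : linear (hpart a).
Proof.
move=> x p q; apply/mpolyP => e; rewrite !(mcoeffD, mcoeffZ, mcoeff_hpart).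
by case: eqP => // _; rewrite mulr0 addr0.
Qed.

HB.instance Definition _ a := GRing.isLinear.Build k R R _ (hpart a) (hpart_is_linear a).

Lemma hpartX a e : hpart a 'X_[e] = if mnm_deg e == a then 'X_[e] else 0.
Proof.
apply/mpolyP => f; rewrite mcoeff_hpart mcoeffX [in RHS]fun_if mcoeffX mcoeff0.
by have [->|_] := eqVneq e f; rewrite // !if_same.
Qed.

Lemma hpart_homog a p : multihomogeneous (hpart a p) a.
Proof.
by apply/multihomogeneousP => e; rewrite mcoeff_hpart; case: (mnm_deg e =P a); rewrite ?eqxx.
Qed.

Lemma hpart_id a p : multihomogeneous p a -> hpart a p = p.
Proof.
move=> /multihomogeneousP hp; apply/mpolyP => e; rewrite mcoeff_hpart.
by case: eqP => // ea; have [->//|/hp] := eqVneq p@_e 0.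
Qed.

Lemma hpartM a b p q : multihomogeneous q b ->
  hpart a (p * q) = hpart (subZm a b) p * q.
Proof.
move=> /multihomogeneousP hq; rewrite [q]mpolyE !mulr_sumr linear_sum /=.
apply: eq_big_seq => f; rewrite mcoeff_msupp => /hq <-.
rewrite -!scalerAr linearZ /=; congr (_ *: _).
rewrite [p]mpolyE mulr_suml !linear_sum mulr_suml /=; apply: eq_bigr => e _.
rewrite -!scalerAl !linearZ /= -scalerAl; congr (_ *: _).
by rewrite -mpolyXD !hpartX mnm_degD; case: eqP; rewrite ?mpolyXD ?mul0r.
Qed.

Lemma multihomogM a b c p q : multihomogeneous p (subZm a b) ->
  multihomogeneous q (subZm b c) -> multihomogeneous (p * q) (subZm a c).
Proof.
move=> hp hq e /msuppM_le /allpairsP[[e1 e2] /= [ep eq ->]] i.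
rewrite -mnm_degE; congr tnth; apply: (@subZmDD a b); apply/eqZmP => j.
  by rewrite mnm_degE; apply: hp.
by rewrite mnm_degE; apply: hq.
Qed.

Lemma multihomog0 a : multihomogeneous (0 : R) a.
Proof. by move=> e; rewrite msupp0. Qed.

Lemma multihomogD a p q : multihomogeneous p a -> multihomogeneous q a ->
  multihomogeneous (p + q) a.
Proof.
by move=> hp hq e /msuppD_le; rewrite mem_cat => /orP[/hp|/hq].
Qed.

Lemma multihomogN a p : multihomogeneous p a -> multihomogeneous (- p) a.
Proof. by move=> hp e; rewrite (perm_mem (msuppN p)) => /hp. Qed.

(** Each graded component is spanned by at most one monomial; if [a] has a negative coordinate, both
    sides are 0. *)
Lemma multihomogE a p : multihomogeneous p a ->
  p = p@_(abs_mnm a) *: 'X_[abs_mnm a].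
Proof.
move=> /multihomogeneousP hp; apply/mpolyP => e; rewrite mcoeffZ mcoeffX.
case: eqP => [->|ne]; rewrite ?mulr1// mulr0.
have [//|/hp ea] := eqVneq p@_e 0; case: ne; apply/mnmP => i.
by rewrite mnmE -ea mnm_degE.
Qed.

(** The degree 0 maps from the sum of the [R(- a i)] to the sum of the [R(- b j)]. *)
Definition mxhomog r s (a : 'I_r -> Zm m) (b : 'I_s -> Zm m) (M : 'M[R]_(r, s)) :=
  forall i j, multihomogeneous (M i j) (subZm (a i) (b j)).

Lemma mxhomogM r s t (a : 'I_r -> Zm m) (b : 'I_s -> Zm m) (c : 'I_t -> Zm m)
    (M : 'M[R]_(r, s)) (N : 'M_(s, t)) :
  mxhomog a b M -> mxhomog b c N -> mxhomog a c (M *m N).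
Proof.
move=> hM hN i j; rewrite mxE; elim/big_ind: _ => [||l _].
- exact: multihomog0.
- exact: multihomogD.
- exact: multihomogM (hM i l) (hN l j).
Qed.

Lemma mxhomogB r s (a : 'I_r -> Zm m) (b : 'I_s -> Zm m) (M N : 'M[R]_(r, s)) :
  mxhomog a b M -> mxhomog a b N -> mxhomog a b (M - N).
Proof.
by move=> hM hN i j; rewrite !mxE; apply: multihomogD => //; apply: multihomogN.
Qed.

Lemma mxhomog1 r (a : 'I_r -> Zm m) : mxhomog a a (1%:M : 'M[R]_r).
Proof.
move=> i j; rewrite mxE; case: eqP => [->|_]; last exact: multihomog0.
move=> e; rewrite msupp1 inE => /eqP -> l.
by rewrite subZmE subrr mnm0E.
Qed.

(** The component of degree [a] of an element of the sum of the [R(- b j)]. *)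
Definition hrow r (b : 'I_r -> Zm m) (a : Zm m) (v : 'rV[R]_r) : 'rV[R]_r :=
  \row_j hpart (subZm a (b j)) (v 0 j).

Lemma hrow_homog r (b : 'I_r -> Zm m) a (v : 'rV_r) i :
  multihomogeneous (hrow b a v 0 i) (subZm a (b i)).
Proof. by rewrite mxE; apply: hpart_homog. Qed.

Lemma hrow_id r (b : 'I_r -> Zm m) a (v : 'rV_r) : mxhomog (fun=> a) b v -> hrow b a v = v.
Proof. by move=> hv; apply/rowP => j; rewrite mxE hpart_id. Qed.

Lemma hrow_mulmx r s (b : 'I_r -> Zm m) (c : 'I_s -> Zm m) a (v : 'rV_r)
    (M : 'M_(r, s)) : mxhomog b c M ->
  hrow c a (v *m M) = hrow b a v *m M.
Proof.
move=> hM; apply/rowP => j; rewrite !mxE linear_sum /=; apply: eq_bigr => i _.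
rewrite (hpartM _ _ (hM i j)) mxE; congr (hpart _ _ * _).
apply/eqZmP => l; rewrite !subZmE.
by rewrite opprB addrA subrK.
Qed.

Lemma hrow_sum r (b : 'I_r -> Zm m) (v : 'rV_r) : exists s, v = \sum_(a <- s) hrow b a v.
Proof.
(* The monomial of exponent [e] in entry [j] has degree [e + b j]; duplicates are removed so that
   each component is counted once. *)
pose D := [seq [tuple tnth (mnm_deg e) i + tnth (b j) i | i < m] : Zm m |
  j <- enum 'I_r, e <- msupp (v 0 j)].
exists (undup D); apply/rowP => j; rewrite summxE; apply/mpolyP => e.
rewrite raddf_sum /=; under eq_bigr do rewrite mxE mcoeff_hpart.
pose a : Zm m := [tuple tnth (mnm_deg e) i + tnth (b j) i | i < m].
have eqa c : (mnm_deg e == subZm c (b j)) = (c == a).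
  apply/eqP/eqP => [/eqZmP ec|->]; apply/eqZmP => i.
    by rewrite [RHS]tnth_mktuple ec subZmE subrK.
  by rewrite subZmE [X in X - _]tnth_mktuple addrK.
under eq_bigr do rewrite eqa.
have [ve|ve] := boolP (e \in msupp (v 0 j)); last first.
  by rewrite memN_msupp_eq0// big1// => c _; rewrite if_same.
rewrite (bigD1_seq a) ?undup_uniq//=; last first.
  rewrite mem_undup; apply/allpairsPdep; exists j, e; split => //.
  by rewrite mem_enum.
by rewrite eqxx big1 ?addr0// => c /negPf ->.
Qed.

End Multigrading.

(** * Independence of Tor from the resolution *)

(** Dependent choice with types varying in the index, as the sizes of the matrices in chain maps and
    homotopies do. *)
Lemma dependent_choice_nat (A : nat -> Type) (Q : forall n, A n -> Prop)
    (S : forall n, A n -> A n.+1 -> Prop) (x0 : A 0%N) : Q 0%N x0 ->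
  (forall n x, Q n x -> exists2 y, Q n.+1 y & S n x y) ->
  exists2 f, f 0%N = x0 & forall n, Q n (f n) /\ S n (f n) (f n.+1).
Proof.
move=> Qx0 step.
have next n (x : {x | Q n x}) : {y | Q n.+1 y & S n (sval x) y}.
  by apply: cid2; apply: step; apply: (svalP x).
pose f := nat_rect (fun n => {x | Q n x}) (exist _ x0 Qx0)
  (fun n x => exist _ (s2val (next n x)) (s2valP (next n x))).
exists (fun n => sval (f n)) => // n.
by split; [exact: svalP|exact: (s2valP' (next n (f n)))].
Qed.

Section Comparison.
Variables (k : fieldType) (m : nat).
Local Notation R := {mpoly k[m]}.
Implicit Types (F G : free_complex k m) (I : set R) (d : nat) (a : Zm m).

(* adiff F d is the differential out of F_d, where F_{-1} = R, so that exactness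
   at F_d takes the same form for d = 0 and for d > 0. *)
Definition arank F d := if d is d'.+1 then frank F d' else 1%N.

Definition adeg F d : 'I_(arank F d) -> Zm m :=
  if d is d'.+1 return 'I_(arank F d) -> Zm m then @fdeg _ _ F d'
  else fun=> mnm_deg 0.

Definition adiff F d : 'M[R]_(frank F d, arank F d) :=
  if d is d'.+1 return 'M_(frank F d, arank F d) then fdiff F d' else faug F.

Definition hommx F G d d' (M : 'M[R]_(frank F d, frank G d')) :=
  mxhomog (@fdeg _ _ F d) (@fdeg _ _ G d') M.

Section Resolution.
Variables (F : free_complex k m) (I : set R) (resF : is_free_resolution F I).

Lemma adiff_homog d : mxhomog (@fdeg _ _ F d) (@adeg F d) (adiff F d).
Proof.
case: d => [|d] i j /=; last exact: (fdiff_homog resF).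
by rewrite ord1 subZm0; apply: (faug_homog resF).
Qed.

Lemma adiff_exact d (u : 'rV_(frank F d)) :
  u *m adiff F d = 0 <-> exists v, v *m fdiff F d = u.
Proof.
case: d u => [|d] u /=.
  have := faug_exact resF; move=> /seteqP[AB BA].
  by split=> [/AB[v _ <-]|[v <-]]; [exists v|apply: BA; exists v].
have := fdiff_exact resF d; move=> /seteqP[AB BA].
by split=> [/AB[v _ <-]|[v <-]]; [exists v|apply: BA; exists v].
Qed.

Lemma fdiff_adiff d : fdiff F d *m adiff F d = 0.
Proof.
apply/row_matrixP => i; rewrite row_mul row0 rowE; apply/adiff_exact.
by eexists.
Qed.

(** Exactness lifts each row, possibly inhomogeneously; the component of the lift in the degree of
    that row still maps to it. *)
Lemma lift_mx d r (a : 'I_r -> Zm m) (U : 'M_(r, frank F d)) :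
  mxhomog a (@fdeg _ _ F d) U -> U *m adiff F d = 0 ->
  exists2 V, mxhomog a (@fdeg _ _ F d.+1) V & V *m fdiff F d = U.
Proof.
move=> hU U0.
have /choice[v vU] i : exists v, v *m fdiff F d = row i U.
  by apply/adiff_exact; rewrite -row_mul U0 row0.
exists (\matrix_i hrow (@fdeg _ _ F d.+1) (a i) (v i)).
  by move=> i j; rewrite mxE; apply: hrow_homog.
apply/row_matrixP => i; rewrite row_mul rowK -(hrow_mulmx _ _ (@adiff_homog d.+1)).
by rewrite vU hrow_id// => j l; rewrite mxE.
Qed.

Lemma lift_aug r (a : 'I_r -> Zm m) (u : 'cV_r) :
  (forall i, multihomogeneous (u i 0) (a i)) -> (forall i, I (u i 0)) ->
  exists2 V, mxhomog a (@fdeg _ _ F 0) V & V *m faug F = u.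
Proof.
move=> hu uI; have := faug_image resF; move=> /seteqP[_ IF].
have /choice[v vu] i : exists v : 'rV_(frank F 0), (v *m faug F) 0 0 = u i 0.
  by have [v _ vu] := IF _ (uI i); exists v.
exists (\matrix_i hrow (@fdeg _ _ F 0) (a i) (v i)).
  by move=> i j; rewrite mxE; apply: hrow_homog.
apply/row_matrixP => i; rewrite row_mul rowK -(hrow_mulmx _ _ (@adiff_homog 0)).
by apply/rowP => j; rewrite [j]ord1 /hrow mxE vu subZm0 hpart_id// mxE.
Qed.

End Resolution.

Section ChainMaps.
Variables (F G : free_complex k m) (I : set R).
Hypotheses (resF : is_free_resolution F I) (resG : is_free_resolution G I).

Definition chain_map (Phi : forall d, 'M[R]_(frank F d, frank G d)) :=
  [/\ forall d, hommx (Phi d), Phi 0%N *m faug G = faug F &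
      forall d, Phi d.+1 *m fdiff G d = fdiff F d *m Phi d].

Lemma chain_map_exists : exists Phi, chain_map Phi.
Proof.
have [i|Phi0 hPhi0 augPhi0] := lift_aug resG (faug_homog resF).
  have := faug_image resF; move=> /seteqP[FI _]; apply: FI.
  by exists (delta_mx 0 i) => //; rewrite -rowE mxE.
have [||Phi Phi_0 PhiP] := @dependent_choice_nat
    (fun d => 'M[R]_(frank F d, frank G d))
    (* The invariant is the cycle condition under which [fdiff F d *m M] lifts through the next
       differential of [G]. *)
    (fun d M => hommx M /\ fdiff F d *m M *m adiff G d = 0)
    (fun d M N => N *m fdiff G d = fdiff F d *m M) Phi0.
- by split=> //; rewrite -mulmxA augPhi0; exact: (fdiff_adiff resF 0).
- move=> d M [hM M0].
  have [|//|N hN NM] := lift_mx resG (a := @fdeg _ _ F d.+1) (U := fdiff F d *m M).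
    by apply: mxhomogM hM; exact: (fdiff_homog resF).
  exists N => //; split=> //=.
  by rewrite -mulmxA NM mulmxA (fdiff_adiff resF d.+1) mul0mx.
exists Phi; split=> [d||d]; first by case: (PhiP d) => -[].
  by rewrite Phi_0.
by case: (PhiP d).
Qed.

End ChainMaps.
Arguments chain_map : clear implicits.

Lemma chain_map_comp F G H Phi Psi : chain_map F G Phi -> chain_map G H Psi ->
  chain_map F H (fun d => Phi d *m Psi d).
Proof.
move=> [h a c] [h' a' c']; split=> [d||d]; first exact: mxhomogM (h d) (h' d).
  by rewrite -mulmxA a' a.
by rewrite -mulmxA c' !mulmxA c.
Qed.

(** An endomorphism over the augmentation is homotopic to the identity, since [Phi - 1] composed
    with the augmentation is 0. *)
Lemma chain_map_homotopy F I (resF : is_free_resolution F I) Phi :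
  chain_map F F Phi -> exists H : forall d, 'M[R]_(frank F d, frank F d.+1),
  [/\ forall d, hommx (H d), Phi 0%N = 1%:M + H 0%N *m fdiff F 0 &
     forall d, Phi d.+1 = 1%:M + H d.+1 *m fdiff F d.+1 + fdiff F d *m H d].
Proof.
move=> [hPhi augPhi Phic].
have hK d : hommx (Phi d - 1%:M).
  exact: mxhomogB (hPhi d) (@mxhomog1 k m _ (@fdeg _ _ F d)).
have [|H0 hH0 H0P] := lift_mx resF (hK 0%N).
  by rewrite /= mulmxBl mul1mx augPhi subrr.
have Kc d : (Phi d.+1 - 1%:M) *m fdiff F d = fdiff F d *m (Phi d - 1%:M).
  by rewrite mulmxBl mulmxBr mul1mx mulmx1 Phic.
have [||H H_0 HP] := @dependent_choice_nat
    (fun d => 'M[R]_(frank F d, frank F d.+1))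
    (* The second conjunct says that [Phi d.+1 - 1 - fdiff F d *m M] is killed by [fdiff F d], so
       that it can be lifted. *)
    (fun d M => hommx M /\
      fdiff F d *m (Phi d - 1%:M) = fdiff F d *m M *m fdiff F d)
    (fun d M N => N *m fdiff F d.+1 = Phi d.+1 - 1%:M - fdiff F d *m M) H0.
- by split=> //; rewrite -mulmxA H0P.
- move=> d M [hM MP].
  have [||N hN NM] := lift_mx resF (U := Phi d.+1 - 1%:M - fdiff F d *m M)
      (a := @fdeg _ _ F d.+1).
  + apply: mxhomogB (hK _) _; apply: mxhomogM hM; exact: (fdiff_homog resF).
  + by rewrite /= mulmxBl Kc MP subrr.
  exists N => //; split=> //.
  by rewrite -mulmxA NM [RHS]mulmxBr mulmxA (fdiff_adiff resF d.+1) mul0mx subr0.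
exists H; split=> [d||d]; first by case: (HP d) => -[].
  by rewrite H_0 H0P addrC subrK.
by have [_ ->] := HP d; rewrite -addrA subrK addrC subrK.
Qed.

Local Notation bar := (map_mx (mcoeff 0%MM)).

(** A homogeneous entry has a nonzero constant term only between generators of equal degree. *)
Lemma tensor_component_mul F G d d' a (M : 'M[R]_(frank F d, frank G d'))
    (v : 'rV_(frank F d)) : hommx M ->
  tensor_component F d a v -> tensor_component G d' a (v *m bar M).
Proof.
move=> hM hv j ja; rewrite mxE big1// => i _; rewrite mxE.
have [ia|ia] := eqVneq (fdeg F i) a; last by rewrite hv// mul0r.
have [->|M0] := eqVneq (M i j)@_0%MM 0; first by rewrite mulr0.
have /multihomogeneousP/(_ _ M0) eqij := hM i j.
case/negP: ja; apply/eqP; rewrite -ia; apply/eqZmP => l.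
have /eqP := congr1 (fun b => tnth b l) eqij.
by rewrite mnm_degE subZmE mnm0E eq_sym subr_eq0 => /eqP.
Qed.

Lemma tor_cycles_submodule F d a : submodule (tor_cycles F d a).
Proof.
split=> [|x u v [hu zu] [hv zv]]; split.
- by move=> j _; rewrite mxE.
- by case: d => [|d] //=; rewrite mul0mx.
- by move=> j ja; rewrite !mxE hu// hv// mulr0 addr0.
- case: d u v hu zu hv zv => [|d] //= u v _ zu _ zv.
  by rewrite mulmxDl -scalemxAl zu zv scaler0 addr0.
Qed.

Lemma tor_boundaries_submodule F d a : submodule (tor_boundaries F d a).
Proof.
split=> [|x u v [w hw <-] [w' hw' <-]].
  by exists 0; [move=> j _; rewrite mxE|rewrite mul0mx].
exists (x *: w + w'); last by rewrite mulmxDl -scalemxAl.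
by move=> j ja; rewrite !mxE hw// hw'// mulr0 addr0.
Qed.

(** Comparison maps in both directions compose to maps homotopic to the identity, so they are
    mutually inverse on Tor. *)
Lemma tor_dim_transfer F G I d a n :
  is_free_resolution F I -> is_free_resolution G I ->
  quotient_dim (tor_cycles F d a) (tor_boundaries F d a) n ->
  quotient_dim (tor_cycles G d a) (tor_boundaries G d a) n.
Proof.
move=> resF resG; have [Phi cPhi] := chain_map_exists resG resF.
have [Psi cPsi] := chain_map_exists resF resG.
have cyc F' G' Th : chain_map F' G' Th -> forall v, tor_cycles F' d a v ->
    tor_cycles G' d a (v *m bar (Th d)).
  move=> [h _ c] v [hv zv]; split; first exact: tensor_component_mul hv.
  case: d v hv zv => [|d'] //= v hv zv.
  by rewrite -mulmxA -map_mxM c map_mxM mulmxA zv mul0mx.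
have bnd F' G' Th : chain_map F' G' Th -> forall v, tor_boundaries F' d a v ->
    tor_boundaries G' d a (v *m bar (Th d)).
  move=> [h _ c] v [w hw <-]; exists (w *m bar (Th d.+1)).
    exact: tensor_component_mul hw.
  by rewrite -!mulmxA -!map_mxM c.
have id_mod F' I' Th : is_free_resolution F' I' -> chain_map F' F' Th ->
    forall v, tor_cycles F' d a v -> tor_boundaries F' d a (v *m bar (Th d) - v).
  move=> res c v [hv zv]; have [H [hH H0 HS]] := chain_map_homotopy res c.
  exists (v *m bar (H d)); first exact: tensor_component_mul hv.
  case: d {cyc bnd} v hv zv => [|d'] //= v hv zv.
    by rewrite H0 map_mxD map_mx1 map_mxM mulmxDr mulmx1 addrC addKr mulmxA.
  rewrite HS !map_mxD map_mx1 !map_mxM !mulmxDr mulmx1 !mulmxA zv mul0mx addr0.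
  by rewrite addrC addKr.
apply: (quotient_dim_pull (f := mulmxr (bar (Phi d)))).
- exact: tor_boundaries_submodule.
- exact: tor_cycles_submodule.
- exact: cyc.
- exact: bnd.
- move=> z zz /= bz.
  have subG := tor_boundaries_submodule G d a.
  have bz' := bnd _ _ _ cPsi _ bz.
  have := id_mod _ _ _ resG (chain_map_comp cPhi cPsi) _ zz.
  rewrite /= map_mxM mulmxA => /(submoduleB subG bz').
  by rewrite opprB addrC subrK.
- move=> z zz; exists (z *m bar (Psi d)); first exact: cyc.
  have subF := tor_boundaries_submodule F d a.
  have := id_mod _ _ _ resF (chain_map_comp cPsi cPhi) _ zz.
  rewrite /= map_mxM mulmxA => /(submoduleZ subF (-1)).
  by rewrite scaleN1r opprB.
Qed.

End Comparison.

(** * Monomial ideals *)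

Section Dickson.

Lemma nondecreasing_subsequence (g : nat -> nat) : exists2 f : nat -> nat,
  {homo f : i j / (i < j)%N} & {homo g \o f : i j / (i <= j)%N}.
Proof.
(* [next N] is a position from [N] on whose value is least among all values from there on. *)
have /choice[next nextP] N : exists i, (N <= i)%N /\ forall j, (N <= j)%N -> (g i <= g j)%N.
  pose A := [pred n | `[< exists2 i, (N <= i)%N & g i = n >]].
  have exA : exists n, A n by exists (g N); apply/asboolP; exists N.
  have [n /asboolP[i Ni <-] minA] := ex_minnP exA; exists i; split => // j Nj.
  by apply: minA; apply/asboolP; exists j.
pose f := fix f n := if n is n'.+1 then next (f n').+1 else next 0%N.
have fS i : (f i < f i.+1)%N by have [] := nextP (f i).+1.
exists f; first exact: (homo_ltn (@ltn_trans) fS).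
apply: (homo_leq leqnn (fun y x z => @leq_trans y x z)) => i /=.
case: i => [|i]; apply: (nextP _).2 => //.
exact: leq_trans (fS i) (ltnW (fS i.+1)).
Qed.

Variable m : nat.
Implicit Types (e f : 'X_{1..m}) (U : set 'X_{1..m}).

(** The sequence is thinned once for each coordinate; monotonicity in earlier coordinates survives
    further thinning. *)
Lemma nondecreasing_mnm_subsequence (g : nat -> 'X_{1..m}) : exists2 f : nat -> nat,
  {homo f : i j / (i < j)%N} & forall i j, (i <= j)%N -> (g (f i) <= g (f j))%MM.
Proof.
suff [f fi fg] : exists2 f : nat -> nat, {homo f : i j / (i < j)%N} &
    forall l, l \in enum 'I_m -> {homo (fun i => g (f i) l) : i j / (i <= j)%N}.
  exists f => // i j ij; apply/mnm_lepP => l.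
  by apply: fg ij; rewrite mem_enum.
elim: (enum 'I_m) => [|l s [f fi fg]]; first by exists id.
have [h hi hg] := nondecreasing_subsequence (fun i => g (f i) l).
exists (f \o h) => [i j ij|l']; first exact/fi/hi.
rewrite inE => /orP[/eqP->|/fg fl'] i j ij; first exact: hg.
apply: fl'; move: ij; rewrite leq_eqVlt => /orP[/eqP->//|/hi]; exact: ltnW.
Qed.

Definition mnm_trunc (n : nat) e : 'X_{1..m} := [multinom minn (e i) n | i < m].

Definition upper U := forall e f, U e -> (e <= f)%MM -> U f.

(** Otherwise pick for each [n] a member of [U] whose truncation at [n] leaves [U], and a
    nondecreasing subsequence of these. Truncated at a bound for the first term, a later term still
    dominates that first term. *)
Lemma upper_trunc U : upper U ->
  exists n0, forall n, (n0 <= n)%N -> forall e, U e -> U (mnm_trunc n e).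
Proof.
move=> upU; suff [n0 n0P] : exists n0, forall e, U e -> U (mnm_trunc n0 e).
  exists n0 => n n0n e /n0P /upU; apply; apply/mnm_lepP => i.
  by rewrite !mnmE leq_min geq_minl /= (leq_trans (geq_minr _ _)).
apply: contrapT => no.
have /choice[g gP] n : exists e, U e /\ ~ U (mnm_trunc n e).
  apply: contrapT => non; apply: no; exists n => e Ue; apply: contrapT => Ute.
  by apply: non; exists e.
have [f fi fg] := nondecreasing_mnm_subsequence g.
(* Since [f N] is at least [N], truncation at [f N] does not cut below [g (f 0)]. *)
pose N := \max_(i < m) g (f 0%N) i.
have fge n : (n <= f n)%N.
  by elim: n => // n IH; apply: leq_ltn_trans IH _; apply: fi.
have [_] := gP (f N); apply; apply: (upU (g (f 0%N))); first by case: (gP (f 0%N)).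
apply/mnm_lepP => i; rewrite mnmE leq_min (mnm_lepP (fg _ _ (leq0n N))) /=.
by apply: leq_trans (fge N); apply: (leq_bigmax (F := fun i => g (f 0%N) i)).
Qed.

End Dickson.

Section MonomialIdeal.
Variables (k : fieldType) (m : nat).
Local Notation R := {mpoly k[m]}.
Implicit Types (I : set R) (U : set 'X_{1..m}).

Lemma ideal_sum I (J : Type) (r : seq J) (F : J -> R) : is_ideal I ->
  (forall j, I (F j)) -> I (\sum_(j <- r) F j).
Proof. by move=> [I0 ID _] IF; elim/big_ind: _. Qed.

Definition supported_in U : set R := [set p | forall e, e \in msupp p -> U e].

Lemma supported_in_ideal U : upper U -> is_ideal (supported_in U).
Proof.
move=> upU; split=> [e|p q hp hq e|p q hq e]; first by rewrite msupp0.
  by move/msuppD_le; rewrite mem_cat => /orP[/hp|/hq].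
move=> /msuppM_le /allpairsP[[e1 e2] /= [_ /hq Ue2 ->]].
exact: upU Ue2 (lem_addl _ _).
Qed.

Lemma monomial_idealP I : is_monomial_ideal I ->
  exists2 U, upper U & I = supported_in U.
Proof.
move=> [G ->]; pose U := [set e | exists2 g, G g & (g <= e)%MM].
have upU : upper U by move=> e f [g Gg ge] ef; exists g => //; apply: lepm_trans ef.
exists U => //; apply/seteqP; split=> p.
  apply; split; first exact: supported_in_ideal.
  by move=> _ [g Gg <-] e /mem_msuppXP <-; exists g => //; exact: lepm_refl.
move=> hp J [idJ GJ]; have [_ _ JM] := idJ; rewrite [p]mpolyE big_seq.
have {}hp e : e \in msupp p -> J (p@_e *: 'X_[e]).
  move=> /hp[g Gg ge]; rewrite -mul_mpolyC; apply: (JM).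
  by rewrite -(submK ge) mpolyXD; apply: (JM); apply: GJ; exists g.
have [J0 JD _] := idJ.
by elim/big_ind: _ => // e /hp.
Qed.

Lemma deg_set_supported_in U : deg_set (supported_in U) = [set mnm_deg e | e in U].
Proof.
apply/seteqP; split=> a /=.
  move=> [p [hp p0 /multihomogeneousP pa]].
  have : msupp p != [::] by rewrite msupp_eq0.
  case E : (msupp p) => [//|e s] _.
  have ep : e \in msupp p by rewrite E mem_head.
  by exists e; [exact: hp|apply: pa; rewrite -mcoeff_msupp].
move=> [e Ue <-]; exists 'X_[e]; split.
- by move=> f /mem_msuppXP <-.
- by rewrite -msupp_eq0 msuppX.
- by move=> f /mem_msuppXP <- i; rewrite mnm_degE.
Qed.

End MonomialIdeal.

(** * The resolution by chains *)

Lemma finite_faces disp (T : porderType disp) (P : set T) (l : seq T) :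
  (forall x, P x -> x \in l) -> exists L : nat -> seq (seq T),
  forall n, uniq (L n) /\ forall s, (s \in L n) <-> face P n s.
Proof.
move=> Pl; pose seqs := fix seqs n : seq (seq T) :=
  if n is n'.+1 then [seq x :: s | x <- l, s <- seqs n'] else [:: [::]].
exists (fun n => undup [seq s <- seqs n | `[< face P n s >]]) => n.
split=> [|s]; first exact: undup_uniq.
rewrite mem_undup mem_filter; split=> [/andP[/asboolP]//|sn].
rewrite (introT (asboolP _) sn) /=; have [ss _ sP] := sn.
elim: n s ss sP {sn} => [|n IH] [|x s] //= [ss] sP.
apply/allpairsP; exists (x, s); split=> //=; first exact/Pl/sP/mem_head.
by apply: IH => // y ys; apply: sP; rewrite /= inE ys orbT.
Qed.

Section ChainResolution.
Variables (k : fieldType) (m : nat) (X : set (Zm m)) (L : nat -> seq (seq (Zm m))).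
Hypothesis L_uniq : forall n, uniq (L n).
Hypothesis L_face : forall n s, (s \in L n) <-> face X n s.
Hypothesis X_ge0 : forall x, X x -> mnm_deg (abs_mnm x) = x.
Hypothesis X_max : forall a x, X x -> (x <= a)%O ->
  exists w, [/\ X w, (w <= a)%O & forall y, X y -> (y <= a)%O -> (y <= w)%O].

Local Notation R := {mpoly k[m]}.
Local Notation C := {freeg (seq (Zm m)) / k}.
Implicit Types (n d : nat) (a x y : Zm m) (c : C) (s t : seq (Zm m)).

Definition top s : Zm m := last (mnm_deg 0) s.

Local Notation Lnth n i := (nth [::] (L n) i).

(** Homological degree [d] uses chains with [d.+1] elements. The simplicial boundary is homogenized
    by the monomial of the difference of tops, which differs from 1 only when the top is deleted. *)
Definition chain_resolution : free_complex k m := {|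
  frank d := size (L d.+1);
  fdeg d i := top (Lnth d.+1 i);
  fdiff d := \matrix_(i, j)
    (coeff (Lnth d.+1 j) (boundary << Lnth d.+2 i >>) *:
     'X_[abs_mnm (subZm (top (Lnth d.+2 i)) (top (Lnth d.+1 j)))]);
  faug := \col_i 'X_[abs_mnm (top (Lnth 1 i))] |}.
Local Notation E := chain_resolution.

Lemma leZmP x y : reflect (forall i, tnth x i <= tnth y i) (x <= y)%O.
Proof. by rewrite leEtprod; apply: forallP. Qed.

Lemma Lnth_face n (i : 'I_(size (L n))) : face X n (Lnth n i).
Proof. by apply/L_face/mem_nth. Qed.

Lemma coeff_Lnth n (i j : 'I_(size (L n))) :
  coeff (Lnth n i) (<< Lnth n j >> : C) = (j == i)%:R.
Proof. by rewrite coeff1 nth_uniq. Qed.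

Lemma chains_expand n c : chains X n c ->
  c = \sum_(i < size (L n)) coeff (Lnth n i) c *: << Lnth n i >>.
Proof.
move=> hc; apply/eqP/freeg_eqP => s; rewrite raddf_sum /=.
have [sL|sL] := boolP (s \in L n); last first.
  rewrite coeff_outdom; last by apply/negP => /hc /L_face; apply/negP.
  rewrite big1// => i _; rewrite coeffZ coeff1; case: eqP => [is_|_]; last by rewrite mulr0.
  by rewrite -is_ mem_nth in sL.
have [i ->] : exists i : 'I_(size (L n)), s = Lnth n i.
  have := sL; rewrite -index_mem => iL; exists (Ordinal iL).
  by rewrite nth_index.
rewrite (bigD1 i)//= coeffZ coeff_Lnth eqxx mulr1 big1 ?addr0// => j /negPf ji.
by rewrite coeffZ coeff_Lnth ji mulr0.
Qed.

Lemma linear_chains_expand (V : lmodType k) (f : {linear C -> V}) n c : chains X n c ->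
  f c = \sum_(i < size (L n)) coeff (Lnth n i) c *: f << Lnth n i >>.
Proof.
move=> hc; rewrite [in LHS](chains_expand hc) linear_sum.
by apply: eq_bigr => i _; rewrite linearZ.
Qed.

Definition upto a := [set x | X x /\ (x <= a)%O].

Lemma face_top n s : face X n.+1 s ->
  [/\ top s \in s, X (top s) & face (upto (top s)) n.+1 s].
Proof.
case/lastP: s => [[]//|s x] sn; rewrite /top last_rcons.
have xs : x \in rcons s x by rewrite mem_rcons mem_head.
have [ss so sP] := sn; split => //; first exact: sP.
split=> // y ys; split; first exact: sP.
move: ys; rewrite /= mem_rcons inE => /orP[/eqP->//|ys].
move: so; rewrite (sorted_pairwise lt_trans) -cats1 pairwise_cat.
by move=> /andP[/allrelP/(_ y x ys (mem_head _ _))/ltW].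
Qed.

Lemma face_upto_top a n s : face (upto a) n.+1 s -> (top s <= a)%O.
Proof.
move=> sn; have [ts _ _] : [/\ top s \in s, X (top s) & face (upto (top s)) n.+1 s].
  by apply: face_top; apply: sub_face sn => x [].
by have [_ _ /(_ _ ts)[]] := sn.
Qed.

Lemma abs_mnm_subD a x y : (x <= a)%O -> (y <= x)%O ->
  (abs_mnm (subZm a x) + abs_mnm (subZm x y))%MM = abs_mnm (subZm a y).
Proof.
move=> /leZmP xa /leZmP yx; apply/mnmP => i; rewrite mnmDE !mnmE !subZmE.
by have := xa i; have := yx i; lia.
Qed.

Lemma abs_mnm_subX a x : X x -> (x <= a)%O ->
  (abs_mnm (subZm a x) + abs_mnm x)%MM = abs_mnm a.
Proof.
move=> /X_ge0/eqZmP x0 /leZmP xa; apply/mnmP => i; rewrite mnmDE !mnmE !subZmE.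
by have := xa i; have := x0 i; rewrite mnm_degE mnmE; lia.
Qed.

Lemma mnm_deg_abs_sub a x : (x <= a)%O -> mnm_deg (abs_mnm (subZm a x)) = subZm a x.
Proof.
move=> /leZmP xa; apply/eqZmP => i; rewrite mnm_degE mnmE subZmE.
by rewrite gez0_abs// subr_ge0.
Qed.

Lemma monomial_homog e a : mnm_deg e = a -> multihomogeneous ('X_[e] : R) a.
Proof. by move=> <- f /mem_msuppXP <- i; rewrite mnm_degE. Qed.

Lemma multihomogZ (x : k) (p : R) a : multihomogeneous p a -> multihomogeneous (x *: p) a.
Proof. by move=> hp e /msuppZ_le /hp. Qed.

(* A chain supported on faces s with top s <= a is an element of degree a of the
   free module on L n: the face s stands for x^(a - top s) times its generator. *)
Definition chain_row n a c : 'rV[R]_(size (L n)) :=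
  \row_j (coeff (Lnth n j) c *: 'X_[abs_mnm (subZm a (top (Lnth n j)))]).

Lemma boundary_top d (i : 'I_(size (L d.+2))) (j : 'I_(size (L d.+1))) :
  coeff (Lnth d.+1 j) (boundary << Lnth d.+2 i >>) != 0 :> k ->
  (top (Lnth d.+1 j) <= top (Lnth d.+2 i))%O.
Proof.
move=> c0; have [_ _ hi] := face_top (Lnth_face i).
have hb := boundary_chains (chains_face hi : chains _ _ (_ : C)).
by have /chainsP/(_ _ c0)/face_upto_top := hb.
Qed.

Lemma chain_row_fdiff d a c : chains (upto a) d.+2 c ->
  chain_row d.+2 a c *m fdiff E d = chain_row d.+1 a (boundary c).
Proof.
move=> hc; have hcX : chains X d.+2 c by apply: sub_chains hc => x [].
apply/rowP => j; rewrite !mxE.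
have -> : coeff (Lnth d.+1 j) (boundary c) = \sum_(i < size (L d.+2))
    coeff (Lnth d.+2 i) c * coeff (Lnth d.+1 j) (boundary << Lnth d.+2 i >>).
  rewrite (linear_chains_expand (@boundary k _ (Zm m)) hcX) raddf_sum /=.
  by apply: eq_bigr => i _; rewrite coeffZ.
rewrite scaler_suml; apply: eq_bigr => i _; rewrite !mxE -scalerAl -scalerAr scalerA.
(* Zero coefficients are split off because exponents add up only when the tops are comparable. *)
have [->|c0] := eqVneq (coeff (Lnth d.+2 i) c) 0; first by rewrite !mul0r !scale0r.
have [->|b0] := eqVneq (coeff (Lnth d.+1 j) (boundary << Lnth d.+2 i >>)) (0 : k).
  by rewrite !mulr0 !scale0r.
rewrite -mpolyXD abs_mnm_subD//; first by have /chainsP/(_ _ c0)/face_upto_top := hc.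
exact: boundary_top.
Qed.

Lemma chain_row_faug a c : chains (upto a) 1 c ->
  (chain_row 1 a c *m faug E) 0 0 = coeff [::] (boundary c) *: 'X_[abs_mnm a].
Proof.
move=> hc; have hcX : chains X 1 c by apply: sub_chains hc => x [].
rewrite !mxE (linear_chains_expand (@boundary k _ (Zm m)) hcX) raddf_sum /=.
rewrite scaler_suml; apply: eq_bigr => i _; rewrite !mxE coeffZ -scalerAl.
have [->|c0] := eqVneq (coeff (Lnth 1 i) c) 0; first by rewrite mul0r !scale0r.
have -> : coeff [::] (boundary << Lnth 1 i >>) = 1 :> k.
  case: (Lnth 1 i) (Lnth_face i) => [[]//|x [|y s] [] //] _ _ _.
  by rewrite boundary_vertex coeff1.
have /chainsP/(_ _ c0) hi := hc; have := face_upto_top hi => ta.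
have [_ Xt _] := face_top (Lnth_face i).
by rewrite mulr1 -mpolyXD abs_mnm_subX.
Qed.

(** A homogeneous entry is a scalar times one monomial, and the scalar is nonzero only if the top is
    at most [a]: the strand of degree [a] is the chain complex of [upto a]. *)
Lemma chain_row_surj d a (u : 'rV[R]_(frank E d)) :
  mxhomog (fun=> a) (@fdeg _ _ E d) u ->
  exists2 c, chains (upto a) d.+1 c & chain_row d.+1 a c = u.
Proof.
move=> hu; pose x (i : 'I_(frank E d)) := (u 0 i)@_(abs_mnm (subZm a (fdeg E i))).
exists (\sum_i x i *: << Lnth d.+1 i >>).
  apply: chains_sum => i _.
  have [->|x0] := eqVneq (x i) 0; first by rewrite scale0r; apply: chains0.
  have /multihomogeneousP/(_ _ x0)/eqZmP ha := hu 0 i.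
  apply/chainsZ/chains_face; have [ss so sP] := Lnth_face i; split => // y ys.
  split; first exact: sP.
  have [_ _ [_ _ /(_ y ys)[_ yt]]] := face_top (Lnth_face i).
  apply: le_trans yt _; apply/leZmP => l; rewrite -subr_ge0.
  by have := ha l; rewrite mnm_degE subZmE => <-.
apply/rowP => j; rewrite mxE raddf_sum (bigD1 j)//= coeffZ coeff_Lnth eqxx mulr1.
rewrite big1 ?addr0; first by rewrite [RHS](multihomogE (hu 0 j)).
by move=> i /negPf ij; rewrite coeffZ coeff_Lnth ij mulr0.
Qed.

Lemma chain_row_eq0 n a c : chains X n c -> chain_row n a c = 0 -> c = 0.
Proof.
move=> hc /rowP c0; rewrite (chains_expand hc) big1// => i _.
have /eqP := c0 i; rewrite !mxE scaler_eq0 -msupp_eq0 msuppX orbF => /eqP ->.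
by rewrite scale0r.
Qed.

Lemma chain_row0 n a : chain_row n a 0 = 0.
Proof. by apply/rowP => j; rewrite !mxE coeff0 scale0r. Qed.

Lemma chain_row_adiff_eq0 d a c : chains (upto a) d.+1 c ->
  chain_row d.+1 a c *m adiff E d = 0 <-> boundary c = 0.
Proof.
move=> hc; have hcX : chains X d.+1 c by apply: sub_chains hc => x [].
have bc := boundary_chains hcX; case: d hc hcX bc => [|d] hc hcX bc /=.
  split=> [/matrixP/(_ 0 0)|c0]; last first.
    by apply/matrixP => i j; rewrite !ord1 chain_row_faug// c0 coeff0 scale0r mxE.
  rewrite chain_row_faug// mxE => /eqP; rewrite scaler_eq0 -msupp_eq0 msuppX orbF.
  move=> /eqP c0; apply/eqP/freeg_eqP => s; rewrite coeff0.
  have [//|s0] := eqVneq (coeff s (boundary c)) 0.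
  by have /chainsP/(_ _ s0)[/size0nil ss _ _] := bc; rewrite ss c0.
rewrite chain_row_fdiff//; split=> [|->]; last exact: chain_row0.
exact: chain_row_eq0.
Qed.

Lemma chain_resolution_adiff_homog d :
  mxhomog (@fdeg _ _ E d) (@adeg _ _ E d) (adiff E d).
Proof.
case: d => [|d] i j; rewrite mxE /=.
  rewrite subZm0; apply/monomial_homog/X_ge0.
  by have [] := face_top (Lnth_face i).
have [->|b0] := eqVneq (coeff (Lnth d.+1 j) (boundary << Lnth d.+2 i >>)) (0 : k).
  by rewrite scale0r; apply: multihomog0.
by apply/multihomogZ/monomial_homog/mnm_deg_abs_sub/boundary_top.
Qed.

Lemma chain_resolution_exact d :
  [set u : 'rV_(frank E d) | u *m adiff E d = 0] =
  range (fun v : 'rV_(frank E d.+1) => v *m fdiff E d).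
Proof.
apply/seteqP; split=> u /=; last first.
  move=> [v _ <-]; rewrite -mulmxA (_ : fdiff E d *m adiff E d = 0) ?mulmx0//.
  apply/row_matrixP => i; rewrite row0 row_mul.
  have [_ _ hi] := face_top (Lnth_face i).
  have -> : row i (fdiff E d) =
      chain_row d.+1 (top (Lnth d.+2 i)) (boundary << Lnth d.+2 i >>).
    by apply/rowP => j; rewrite !mxE.
  apply/chain_row_adiff_eq0; last exact: boundaryK.
  exact/boundary_chains/chains_face.
(* Exactness is checked on each graded component; there it is acyclicity of [upto a], which has a
   greatest element when nonempty. *)
move=> u0; have [D uD] := hrow_sum (@fdeg _ _ E d) u.
have /choice[v vP] a : exists v, v *m fdiff E d = hrow (@fdeg _ _ E d) a u.
  have [|c hc cu] := @chain_row_surj d a (hrow (@fdeg _ _ E d) a u).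
    by move=> i j; rewrite ord1; apply: hrow_homog.
  have bc : boundary c = 0.
    apply/(chain_row_adiff_eq0 hc); rewrite cu.
    rewrite -(hrow_mulmx _ _ (@chain_resolution_adiff_homog d)) u0.
    by apply/rowP => j; rewrite !mxE linear0.
  have [[x [Xx xa]]|no] := pselect (exists x, upto a x).
    have [w [Xw wa maxw]] := X_max Xx xa.
    have [e he ec] : boundaries (upto a) d.+1 c.
      by apply: (@acyclic_max _ _ _ _ w) => // y [Xy ya]; apply: maxw.
    by exists (chain_row d.+2 a e); rewrite chain_row_fdiff// ec.
  (* With [upto a] empty there are no faces with [d.+1] vertices, so the component is 0. *)
  exists 0; rewrite mul0mx -cu.
  suff -> : c = 0 by rewrite chain_row0.
  rewrite (freegE c) big_seq big1// => s /hc[ss _ sP]; case: no.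
  by case: s ss sP => // x s _ sP; exists x; apply/sP/mem_head.
exists (\sum_(a <- D) v a) => //.
by rewrite mulmx_suml [RHS]uD; apply: eq_bigr => a _; rewrite vP.
Qed.

Lemma chain_resolution_free I : is_ideal I ->
  (forall e, I 'X_[e] <-> exists2 x, X x & (x <= mnm_deg e)%O) ->
  (forall p e, I p -> e \in msupp p -> I 'X_[e]) ->
  is_free_resolution E I.
Proof.
move=> idI IX Isupp; have [I0 ID IM] := idI.
split.
- by move=> i; rewrite -(subZm0 (fdeg E i)); exact: (@chain_resolution_adiff_homog 0 i 0).
- by move=> d; exact: (@chain_resolution_adiff_homog d.+1).
- apply/seteqP; split=> p.
    move=> [u _ <-]; rewrite mxE; apply: ideal_sum => // i; rewrite mxE; apply: IM.
    have [_ Xt _] := face_top (Lnth_face i).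
    by apply/IX; exists (top (Lnth 1 i)); rewrite // X_ge0.
  move=> Ip; rewrite [p]mpolyE big_seq.
  have SX e : e \in msupp p -> exists u : 'rV_(frank E 0), (u *m faug E) 0 0 = 'X_[e].
    move=> /(Isupp _ _ Ip)/IX[x Xx xe].
    have : [:: x] \in L 1 by apply/L_face; split => // y; rewrite /= inE => /eqP->.
    rewrite -index_mem => iL; pose i : 'I_(frank E 0) := Ordinal iL.
    exists ('X_[abs_mnm (subZm (mnm_deg e) x)] *: delta_mx 0 i).
    rewrite -scalemxAl -rowE !mxE nth_index; last by rewrite -index_mem.
    rewrite -mpolyXD abs_mnm_subX//.
    by congr 'X_[_]; apply/mnmP => l; rewrite mnmE mnm_degE.
  elim/big_ind: _ => [|q q' [u _ <-] [v _ <-]|e /SX[u <-]].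
  + by exists 0; rewrite // mul0mx mxE.
  + by exists (u + v); rewrite // mulmxDl mxE.
  + by exists ((p@_e)%:MP *: u); rewrite // -scalemxAl mxE mul_mpolyC.
- exact: (chain_resolution_exact 0).
- by move=> d; exact: (chain_resolution_exact d.+1).
Qed.

(** * Tor of the chain resolution in a fixed multidegree *)

Section Tor.
Variables (a : Zm m) (Xa : X a).

(** Appending [a] turns a face with [d] vertices below [a] into a generator of degree [a] in
    homological degree [d]; this is the shift from [d] to [d - 1] in the theorem. *)
Definition tor_row d : C -> 'rV[k]_(frank E d) :=
  fun c => \row_j coeff (Lnth d.+1 j) (append [:: a] c).

Lemma tor_row_is_linear d : linear (tor_row d).
Proof. by move=> x u v; apply/rowP => j; rewrite !mxE linearP coeffD coeffZ. Qed.

HB.instance Definition _ d :=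
  GRing.isLinear.Build k C 'rV[k]_(frank E d) _ (tor_row d) (tor_row_is_linear d).

Lemma coeff_append s c t : coeff s (append t c) =
  \sum_(u <- dom c) coeff u c * (u ++ t == s)%:R.
Proof.
by rewrite /append fgliftE raddf_sum; apply: eq_bigr => u _ /=; rewrite coeffZ coeff1.
Qed.

Lemma coeff_append_top s c : coeff s (append [:: a] c) != 0 -> top s = a.
Proof.
rewrite coeff_append; apply: contra_neqP => sa; rewrite big1// => u _.
case: eqP => [us|_]; last by rewrite mulr0.
by case: sa; rewrite -us cats1 /top last_rcons.
Qed.

Lemma coeff_append_cat s c : coeff (s ++ [:: a]) (append [:: a] c) = coeff s c.
Proof.
rewrite coeff_append; under eq_bigr => u _ do rewrite !cats1 eqseq_rcons eqxx andbT.
have [sc|sc] := boolP (s \in dom c); last first.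
  rewrite coeff_outdom// big_seq big1// => u uc; case: eqP => [us|]; last by rewrite mulr0.
  by rewrite -us uc in sc.
rewrite (bigD1_seq s) ?uniq_dom//= eqxx mulr1 big1 ?addr0// => u /negPf ->.
by rewrite mulr0.
Qed.

Lemma face_append n s : face (below X a) n s -> face X n.+1 (s ++ [:: a]).
Proof.
move=> sn; rewrite -addn1; apply: face_cat sn _ _; last by move=> z; rewrite inE => /eqP->.
by split=> // y; rewrite /= inE => /eqP->.
Qed.

Lemma face_take n s : face X n.+1 s -> top s = a ->
  exists2 t, face (below X a) n t & s = t ++ [:: a].
Proof.
case/lastP: s => [[]//|s x]; rewrite /top last_rcons => -[ss so sP] xa.
exists s; last by rewrite xa cats1.
move: so; rewrite (sorted_pairwise lt_trans) -cats1 pairwise_cat xa.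
move=> /and3P[/allrelP sa so _]; split; last 1 first.
- move=> y ys; split; last by apply: sa ys (mem_head _ _).
  by apply: sP; rewrite /= mem_rcons inE ys orbT.
- by apply/eqP; rewrite -eqSS -ss size_rcons.
- by rewrite (sorted_pairwise lt_trans).
Qed.

Lemma tor_row_component d c : tensor_component E d a (tor_row d c).
Proof.
move=> j /= ja; rewrite mxE; apply/eqP.
by apply: contraNT ja => /coeff_append_top/eqP.
Qed.

Lemma tor_row_inj d c : chains (below X a) d c -> tor_row d c = 0 -> c = 0.
Proof.
move=> hc /rowP c0; apply/eqP/freeg_eqP => s; rewrite coeff0.
have [//|s0] := eqVneq (coeff s c) 0.
have /chainsP/(_ _ s0)/face_append/L_face sL := hc.
have iL : (index (s ++ [:: a]) (L d.+1) < size (L d.+1))%N by rewrite index_mem.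
by have := c0 (Ordinal iL); rewrite !mxE nth_index// coeff_append_cat.
Qed.

Lemma tor_row_surj d (v : 'rV_(frank E d)) : tensor_component E d a v ->
  exists2 c, chains (below X a) d c & tor_row d c = v.
Proof.
move=> hv; exists (\sum_j v 0 j *: << take d (Lnth d.+1 j) >>).
  apply: chains_sum => j _; have [ja|ja] := eqVneq (fdeg E j) a; last first.
    by rewrite hv// scale0r; apply: chains0.
  apply/chainsZ/chains_face; have [t td ->] := face_take (Lnth_face j) ja.
  by have [st _ _] := td; rewrite take_size_cat.
apply/rowP => l; rewrite mxE linear_sum raddf_sum (bigD1 l)//=.
have termE j : coeff (Lnth d.+1 l) (append [:: a] (v 0 j *: << take d (Lnth d.+1 j) >>)) =
    v 0 j * (j == l)%:R.
  have [ja|ja] := eqVneq (fdeg E j) a; last by rewrite hv// scale0r linear0 coeff0 mul0r.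
  rewrite linearZ /= coeffZ append1; have [t td et] := face_take (Lnth_face j) ja.
  have [st _ _] := td; rewrite {1}et take_size_cat// -et.
  by rewrite coeff_Lnth.
by rewrite termE eqxx mulr1 big1 ?addr0// => j /negPf jl; rewrite termE jl mulr0.
Qed.

(** The boundary of [c] with [a] appended is the boundary of [c] with [a] appended, plus or minus
    [c]. Reduction to constant terms keeps only faces with top [a], which removes [c]. *)
Lemma tor_row_boundary d c : chains (below X a) d.+1 c ->
  tor_row d.+1 c *m tensor_diff E d = tor_row d (boundary c).
Proof.
move=> hc; have hca : chains X d.+2 (append [:: a] c).
  by apply: linear_chains hc => s hs /=; rewrite append1; exact/chains_face/face_append.
have bca : boundary (append [:: a] c) =
    append [:: a] (boundary c) + (-1) ^+ d.+1 *: c.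
  rewrite (boundary_append _ hc) boundary_vertex fglift1; congr (_ + _ *: _).
  rewrite -[RHS](_ : idfun c = c)//.
  by apply: (@eq_linear_freeg _ _ _ (append [::]) idfun) => s _ /=; rewrite append1 cats0.
apply/rowP => j; rewrite !mxE.
transitivity ((top (Lnth d.+1 j) == a)%:R *
    coeff (Lnth d.+1 j) (boundary (append [:: a] c))).
  rewrite (linear_chains_expand (@boundary k _ (Zm m)) hca) raddf_sum /= mulr_sumr.
  apply: eq_bigr => i _; rewrite !mxE mcoeffZ mcoeffX coeffZ [RHS]mulrCA.
  have [->|c0] := eqVneq (coeff (Lnth d.+2 i) (append [:: a] c)) 0; first by rewrite !mul0r.
  congr (_ * _); rewrite mulrC.
  have [->|b0] := eqVneq (coeff (Lnth d.+1 j) (boundary << Lnth d.+2 i >>)) (0 : k).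
    by rewrite !mulr0.
  have /leZmP ji := boundary_top b0; move: ji; rewrite (coeff_append_top c0) => ji.
  congr (_%:R * _); congr (nat_of_bool _); apply/eqP/eqP => [ij|->].
    apply/eqZmP => l; have /mnmP/(_ l) := ij.
    by rewrite mnmE subZmE mnm0E; have := ji l; lia.
  by apply/mnmP => l; rewrite mnmE subZmE mnm0E subrr.
rewrite bca coeffD coeffZ; case: eqP => [ja|ja]; last first.
  by rewrite mul0r; apply/esym/eqP; apply: contra_notT ja => /coeff_append_top.
rewrite mul1r; have [->|cj] := eqVneq (coeff (Lnth d.+1 j) c) 0.
  by rewrite mulr0 addr0.
have /chainsP/(_ _ cj)[_ _ jP] := hc.
have [tj _ _] := face_top (Lnth_face j).
by have [_] := jP _ tj; rewrite ja ltxx.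
Qed.

Lemma tor_chain_resolution d n :
  quotient_dim (tor_cycles E d a) (tor_boundaries E d a) n ->
  reduced_homology_dim k (below X a) d n.
Proof.
apply: (quotient_dim_pull (f := tor_row d)).
- exact: tor_boundaries_submodule.
- split=> [|x u v [hu bu] [hv bv]]; first by split; [exact: chains0|exact: linear0].
  by split; [apply: chainsD => //; exact: chainsZ|rewrite linearP /= bu bv scaler0 addr0].
- move=> c [hc bc]; split; first exact: tor_row_component.
  by case: d hc => [|d'] hc //=; rewrite tor_row_boundary// bc linear0.
- move=> c [e he <-]; exists (tor_row d.+1 e); first exact: tor_row_component.
  exact: tor_row_boundary.
- move=> c [hc bc] [w hw wc]; have [e he ew] := tor_row_surj hw; exists e => //.
  apply/eqP; rewrite -subr_eq0; apply/eqP; apply: (@tor_row_inj d).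
    by apply: chainsB => //; apply: boundary_chains.
  by rewrite linearB /= -tor_row_boundary// ew wc subrr.
- move=> v [hv zv]; have [c hc cv] := tor_row_surj hv; exists c; last first.
    by rewrite [X in _ - X]cv subrr; exact: (tor_boundaries_submodule E d a).1.
  split=> //; case: d v hv zv hc cv => [|d'] v hv zv hc cv.
    exact: boundary_chains0 hc.
  apply: (@tor_row_inj d'); first exact: boundary_chains.
  by rewrite -tor_row_boundary// cv.
Qed.

End Tor.

End ChainResolution.

(** * Betti numbers *)

Section BettiNumbers.
Variables (k : fieldType) (m : nat).
Local Notation R := {mpoly k[m]}.

Definition cube M : seq (Zm m) :=
  [seq mnm_deg [multinom f i : nat | i < m] | f : {ffun 'I_m -> 'I_M.+1}].

Lemma mem_cube M (e : 'X_{1..m}) : (forall i, e i <= M)%N -> mnm_deg e \in cube M.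
Proof.
move=> eM; apply/mapP; exists [ffun i => inord (e i)]; first by rewrite mem_enum.
by congr mnm_deg; apply/mnmP => i; rewrite mnmE ffunE inordK// ltnS.
Qed.

Lemma mnm_degK : cancel (@mnm_deg m) (@abs_mnm m).
Proof. by move=> e; apply/mnmP => i; rewrite mnmE mnm_degE. Qed.

Lemma le_mnm_deg (e f : 'X_{1..m}) : (mnm_deg e <= mnm_deg f)%O = (e <= f)%MM.
Proof.
by apply/leZmP/mnm_lepP => ef i; have := ef i; rewrite !mnm_degE lez_nat.
Qed.

Lemma mnm_deg_bound (a : Zm m) : exists N, forall e, (mnm_deg e <= a)%O ->
  forall i, (e i <= N)%N.
Proof.
exists (\max_(i < m) absz (tnth a i)) => e /leZmP ea i.
apply: leq_trans (leq_bigmax i); have := ea i; rewrite mnm_degE; lia.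
Qed.

Lemma resolution_reduced_homology (U : set 'X_{1..m}) (a : Zm m) : upper U ->
  [set mnm_deg e | e in U] a ->
  exists2 F, is_free_resolution F (supported_in U : set R) &
    forall d n, quotient_dim (tor_cycles F d a) (tor_boundaries F d a) n ->
      reduced_homology_dim k (below [set mnm_deg e | e in U] a) d n.
Proof.
move=> upU [f Uf fa]; have [n0 truncU] := upper_trunc upU.
have [N aN] := mnm_deg_bound a; pose M := maxn n0 N.
pose X : set (Zm m) := [set mnm_deg e | e in [set e | U e /\ forall i, (e i <= M)%N]].
have Xcube x : X x -> x \in cube M by move=> [e [_ eM] <-]; exact: mem_cube.
have [L LP] := finite_faces Xcube.
have L_uniq n : uniq (L n) by case: (LP n).
have L_face n s : s \in L n <-> face X n s by case: (LP n).
have X_ge0 x : X x -> mnm_deg (abs_mnm x) = x by move=> [e _ <-]; rewrite mnm_degK.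
have leM e : (mnm_deg e <= a)%O -> forall i, (e i <= M)%N.
  by move=> ea i; apply: leq_trans (aN _ ea i) (leq_maxr _ _).
have Xtrunc e : U e -> X (mnm_deg (mnm_trunc M e)).
  move=> Ue; exists (mnm_trunc M e) => //; split; first exact: truncU (leq_maxl _ _) _ Ue.
  by move=> i; rewrite mnmE geq_minr.
have trunc_le e : (mnm_trunc M e <= e)%MM by apply/mnm_lepP => i; rewrite mnmE geq_minl.
have X_max b x : X x -> (x <= b)%O ->
    exists w, [/\ X w, (w <= b)%O & forall y, X y -> (y <= b)%O -> (y <= w)%O].
  move=> [e [Ue eM] <-] eb; have b0 : b = mnm_deg (abs_mnm b).
    apply/eqZmP => i; rewrite mnm_degE mnmE gez0_abs//.
    by apply: le_trans (leZmP _ _ eb i); rewrite mnm_degE.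
  rewrite {}b0 in eb *; move: (abs_mnm b) eb => g; rewrite le_mnm_deg => eg.
  exists (mnm_deg (mnm_trunc M g)); split.
  - exact/Xtrunc/(upU e).
  - by rewrite le_mnm_deg.
  - move=> _ [h [Uh hM] <-]; rewrite !le_mnm_deg => /mnm_lepP hg.
    by apply/mnm_lepP => i; rewrite mnmE leq_min hg hM.
exists (chain_resolution k L).
  apply: (chain_resolution_free L_uniq L_face X_ge0 X_max).
  - exact: supported_in_ideal.
  - move=> e; split=> [/(_ e)|[_ [f' [Uf' _] <-]]].
      rewrite msuppX mem_head => /(_ isT) Ue; exists (mnm_deg (mnm_trunc M e)).
        exact: Xtrunc.
      by rewrite le_mnm_deg.
    by rewrite le_mnm_deg => f'e g /mem_msuppXP <-; apply: upU f'e.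
  - by move=> p e hp /hp Ue g /mem_msuppXP <-.
have Xa : X a by exists f => //; split=> //; apply: leM; rewrite fa.
have -> : below [set mnm_deg e | e in U] a = below X a.
  apply/seteqP; split=> x [[e Ue <-] xa]; split=> //; last by case: Ue => ? _; exists e.
  by exists e => //; split=> //; apply: leM; apply: ltW.
by move=> d n; exact: tor_chain_resolution.
Qed.

Lemma betti_reduced_homology (I : set R) (a : Zm m) d : is_monomial_ideal I ->
  deg_set I a -> reduced_homology_dim k (below (deg_set I) a) d (betti I d a).
Proof.
move=> /monomial_idealP[U upU ->]; rewrite deg_set_supported_in => Ua.
have [F resF homF] := resolution_reduced_homology upU Ua; apply: homF.
have [n nF] := quotient_dim_exists (tor_cycles_submodule F d a)
  (tor_boundaries_submodule F d a).
(* The set defining [betti] contains the dimension computed on [F], so its value is not the default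
   0 but comes from some resolution [G], and is carried over to [F]. *)
have [|G resG dimG] := @xgetPex _ 0%N [set n | exists2 G,
    is_free_resolution G (supported_in U : set R) &
    quotient_dim (tor_cycles G d a) (tor_boundaries G d a) n].
  by exists n, F.
exact: tor_dim_transfer resG resF dimG.
Qed.

Lemma below_finite (I : set R) (a : Zm m) : is_monomial_ideal I ->
  exists l : seq (Zm m), forall x, below (deg_set I) a x -> x \in l.
Proof.
move=> /monomial_idealP[U upU ->]; rewrite deg_set_supported_in.
have [N aN] := mnm_deg_bound a; exists (cube N) => _ [[e Ue <-] ea].
by apply/mem_cube/aN/ltW.
Qed.

End BettiNumbers.

(** * From the degree set to intermediate posets *)

Lemma below_below disp (T : porderType disp) (P : set T) (a x : T) : (x < a)%O ->
  below (below P a) x = below P x.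
Proof.
move=> xa; apply/seteqP; split=> y [Py yx]; first by case: Py.
by split=> //; split=> //; apply: lt_trans yx xa.
Qed.

Lemma below_subset disp (T : porderType disp) (P Q : set T) (a : T) : Q `<=` P ->
  below Q a `<=` below P a.
Proof. by move=> QP x [/QP]. Qed.

Lemma reduced_homology_eq0 (k : fieldType) disp (T : porderType disp) (P : set T) :
  (forall n, reduced_homology_dim k P n 0) -> acyclic k P.
Proof.
move=> h n; apply/(quotient_dim_eq0 _ (h n)) => //.
by exists 0; [exact: chains0|exact: linear0].
Qed.

(** Points of [P] outside [Q] have vanishing Betti numbers, so by [dimP] their lower segments in [P]
    are acyclic. This serves for [P] inside the degree set and for the Betti poset inside [P]. *)
Lemma betti_relatively_acyclic (k : fieldType) m (I : set {mpoly k[m]})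
    (Q P : set (Zm m)) (a : Zm m) : is_monomial_ideal I ->
  betti_poset I `<=` Q -> Q `<=` P -> P `<=` deg_set I ->
  (forall x d, P x -> reduced_homology_dim k (below P x) d (betti I d x)) ->
  relatively_acyclic k (below Q a) (below P a).
Proof.
move=> monI BQ QP PD dimP; have [l lP] := below_finite a monI.
apply: (@acyclic_relatively _ _ _ _ _ l); first exact: below_subset.
  by move=> x [Px xa] _; apply: lP; split=> //; apply: PD.
move=> x [Px xa] Qx; rewrite below_below//; apply: reduced_homology_eq0 => d.
have := dimP x d Px; suff -> : betti I d x = 0%N by [].
by apply: contra_notP Qx => /eqP b0; split=> //; apply: BQ; exists d.
Qed.

Theorem theorem5p2 (k : fieldType) (m : nat) (I : set {mpoly k[m]})
    (P : set (Zm m)) (monI : is_monomial_ideal I)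
    (BP : betti_poset I `<=` P) (Pdeg : P `<=` deg_set I) :
  [/\ forall (a : Zm m) (d : nat),
        (~ P a -> betti I d a = 0%N) /\
        (P a -> reduced_homology_dim k (below P a) d (betti I d a)),
      betti_poset I =
        [set a | P a /\ exists n, reduced_homology_nonzero k (below P a) n]
    & forall a : Zm m, betti_poset I a ->
        inclusion_homology_iso k (below (betti_poset I) a) (below P a)].
Proof.
have homD x d := @betti_reduced_homology k m I x d monI.
have homP a d : P a -> reduced_homology_dim k (below P a) d (betti I d a).
  move=> Pa; have := homD _ d (Pdeg _ Pa).
  (* Here [P] is the smaller set and the degree set the larger, where the Betti numbers are already
     known to be homology dimensions. *)
  have r := betti_relatively_acyclic (a := a) monI BP Pdeg (fun _ => id) homD.
  have sub := @below_subset _ _ _ _ a Pdeg.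
  apply: (quotient_dim_pull (f := idfun)) => /=.
  - split=> [|x _ _ [u hu <-] [v hv <-]].
      by exists 0; [exact: chains0|exact: linear0].
    exists (x *: u + v); last by rewrite linearP.
    by apply: chainsD => //; apply: chainsZ.
  - split=> [|x u v [hu bu] [hv bv]]; first by split; [exact: chains0|exact: linear0].
    by split; [apply: chainsD => //; exact: chainsZ|rewrite linearP /= bu bv scaler0 addr0].
  - by move=> z [hz bz]; split=> //; apply: sub_chains hz.
  - by move=> _ [e he <-]; exists e => //; apply: sub_chains he.
  - by move=> z [hz _]; apply: relatively_acyclic_inj.
  - move=> z [hz bz]; have [|z' hz' [bz' zz']] := relatively_acyclic_surj r hz.
      by rewrite bz; apply: chains0.
    by exists z' => //; split=> //; rewrite bz'.
have nzP a d : P a -> betti I d a != 0%N <-> reduced_homology_nonzero k (below P a) d.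
  move=> Pa; have B0 : boundaries (below P a) d (0 : {freeg (seq (Zm m)) / k}).
    by exists 0; [exact: chains0|exact: linear0].
  have eq0 := quotient_dim_eq0 B0 (homP a d Pa); split=> [/eqP b0|[c zc bc]].
    apply: contrapT => no; apply/b0/eq0 => c zc; apply: contrapT => bc.
    by apply: no; exists c.
  by apply/eqP => /eq0 /(_ _ zc).
split=> [a d||a _].
- split=> [Pa|]; last exact: homP.
  by apply: contra_notP Pa => /eqP b0; apply: BP; exists d.
- apply/seteqP; split=> a [].
    by move=> d bd; have Pa : P a by [apply: BP; exists d]; split=> //; exists d; apply/nzP.
  by move=> Pa [d /(nzP _ _ Pa) bd]; exists d.
- apply: relatively_acyclic_homology_iso.
  (* Now [P] is the larger set, with [homP] supplying the dimensions there. *)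
  exact: betti_relatively_acyclic monI (fun _ => id) BP Pdeg homP.
Qed.
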